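(* For any $x=(a,b,p)\in\mathbb{E}$, $$\mathcal{C}_{\mathbb{E}}(0,x)=\mathcal{K}_{\mathbb{E}}(0,x)=\delta_{\mathbb{E}}(0,x)=\max\left\{\tanh^{-1}\frac{|a-\bar bp|+|ab-p|}{1-|b|^2},\ \tanh^{-1}\frac{|b-\bar ap|+|ab-p|}{1-|a|^2}\right\}.$$
   Context: $\mathbb{D}$ is the open unit disc. The tetrablock is $\mathbb{E}=\{x\in\mathbb{C}^3: 1-x_1z-x_2w+x_3zw\ne0 \text{ whenever } |z|\le1,\ |w|\le1\}$. With $d(\lambda,\mu)=\left|\frac{\lambda-\mu}{1-\bar\mu\lambda}\right|$ on $\mathbb{D}$: the Carathéodory distance is $\mathcal{C}_{\mathbb{E}}(x,y)=\sup\{\tanh^{-1}d(f(x),f(y)): f:\mathbb{E}\to\mathbb{D}\text{ analytic}\}$; the Lempert function is $\delta_{\mathbb{E}}(x,y)=\inf\{\tanh^{-1}d(\lambda,\mu):\ \text{there is an analytic }\varphi:\mathbb{D}\to\mathbb{E}\text{ with }\varphi(\lambda)=x,\ \varphi(\mu)=y\}$; the Kobayashi distance $\mathcal{K}_{\mathbb{E}}$ is the largest pseudodistance on $\mathbb{E}$ that is $\le\delta_{\mathbb{E}}$. *)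

(* Defs.v *)
From Stdlib Require Import Reals ClassicalEpsilon.
From Coquelicot Require Import Coquelicot.

Open Scope R_scope.

(* C^3 over the complex scalars, so that differentials into and out of it are
   required to be C-linear; the triple (a, b, p) is an element of it. *)
Definition C3 : NormedModule C_AbsRing :=
  prod_NormedModule C_AbsRing
    (prod_NormedModule C_AbsRing C_NormedModule C_NormedModule) C_NormedModule.

Definition origin : C3 := (RtoC 0, RtoC 0, RtoC 0).

Definition disc (z : C) : Prop := Cmod z < 1.

Definition tetrablock (x : C3) : Prop :=
  let '(x1, x2, x3) := x in
  forall z w : C, Cmod z <= 1 -> Cmod w <= 1 ->
    (1 - x1 * z - x2 * w + x3 * z * w)%C <> RtoC 0.

(* The inverse of tanh; meaningful for -1 < r < 1. *)
Definition atanh (r : R) : R := / 2 * ln ((1 + r) / (1 - r)).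

(* Meaningful for l and m in the disc. *)
Definition mobius_dist (l m : C) : R :=
  Cmod ((l - m) / (1 - Cconj m * l))%C.

(* Analytic maps are total functions that are complex differentiable at every
   point of an open set (here U, resp. the disc); values outside are irrelevant. *)
Definition analytic_to_disc (U : C3 -> Prop) (f : C3 -> C_NormedModule) : Prop :=
  forall x : C3, U x -> disc (f x) /\ ex_filterdiff f (locally x).

Definition analytic_disc_in (U : C3 -> Prop) (phi : C_AbsRing -> C3) : Prop :=
  forall l : C, disc l -> U (phi l) /\ ex_derive phi l.

Definition caratheodory (U : C3 -> Prop) (x y : C3) : Rbar :=
  Lub_Rbar (fun r : R => exists f : C3 -> C_NormedModule,
    analytic_to_disc U f /\ r = atanh (mobius_dist (f x) (f y))).

(* The infimum over the empty set of discs is p_infty. *)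
Definition lempert (U : C3 -> Prop) (x y : C3) : Rbar :=
  Glb_Rbar (fun r : R => exists (l m : C) (phi : C_AbsRing -> C3),
    disc l /\ disc m /\ analytic_disc_in U phi /\
    phi l = x /\ phi m = y /\ r = atanh (mobius_dist l m)).

Definition pseudodistance (U : C3 -> Prop) (rho : C3 -> C3 -> R) : Prop :=
  (forall x y, U x -> U y -> 0 <= rho x y) /\
  (forall x, U x -> rho x x = 0) /\
  (forall x y, U x -> U y -> rho x y = rho y x) /\
  (forall x y z, U x -> U y -> U z -> rho x z <= rho x y + rho y z).

Definition below_lempert (U : C3 -> Prop) (rho : C3 -> C3 -> R) : Prop :=
  forall x y, U x -> U y -> Rbar_le (Finite (rho x y)) (lempert U x y).

Definition is_kobayashi (U : C3 -> Prop) (k : C3 -> C3 -> R) : Prop :=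
  pseudodistance U k /\ below_lempert U k /\
  forall rho, pseudodistance U rho -> below_lempert U rho ->
    forall x y, U x -> U y -> rho x y <= k x y.

(* "The" largest pseudodistance below the Lempert function.  is_kobayashi
   determines k on U * U.  On the tetrablock such a k exists: every point x lies
   with the origin on a disc l |-> (s l x1, s l x2, s^2 l^2 x3) with s > 1, so the
   pseudodistances below the Lempert function are pointwise bounded and their
   pointwise supremum is the largest one. *)
Definition kobayashi (U : C3 -> Prop) : C3 -> C3 -> R :=
  epsilon (inhabits (fun _ _ => 0)) (is_kobayashi U).

(* Main.v *)
Require Import Defs.
From Stdlib Require Import Reals Lra ClassicalEpsilon.
From Coquelicot Require Import Coquelicot.

(** The functions [x |-> c (x1 - w x3) / (1 - w x2)], with [c] and [w] unimodular,
    map the tetrablock into the disc and vanish at the origin; optimising [w]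
    gives the value [r = gauge a b p] at [(a, b, p)], and exchanging the first
    two coordinates gives [gauge b a p].  Conversely, when [|b| <= |a|], the
    optimal [w] puts the point in the normal form
      [a = om r (1 - k + k s)],  [b = s / w],  [p = om r (s - k + k s) / w]
    with [0 <= k < 1], and with [q = s / (r (1 - k + k s))], [|q| <= 1], the disc
      [l |-> (om (1 - k) l, (1 - k) q l / w, om l (q l - k) / w) / (1 - k q l)]
    lies in the tetrablock and reaches [(a, b, p)] at [l = r].  The Schwarz-Pick
    lemma makes these functions and discs extremal.  It is obtained from
    Goursat's theorem for a map that is only pointwise differentiable: the mean
    value property of [k z / z] on circles gives [|k'(0)| <= 1], and the resulting
    infinitesimal bound is integrated along hyperbolic segments. *)

(** * Complex derivatives *)

(** The codomain is the field as a module over itself, the setting of the product and chain rules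
    for scalar functions; [filterdiff_C_codomain] passes to the [C_NormedModule] of the
    definitions. *)
Definition is_cderive (f : C -> C) (z d : C) : Prop :=
  @is_derive C_AbsRing (AbsRing_NormedModule C_AbsRing) f z d.

Lemma is_cderive_eps (f : C -> C) (z d : C) :
  is_cderive f z d <->
  forall eps : R, 0 < eps -> exists delta : R, 0 < delta /\
    forall w : C, Cmod (w - z)%C < delta ->
      Cmod (f w - f z - d * (w - z))%C <= eps * Cmod (w - z)%C.
Proof.
  split.
  - intros [_ H] eps He.
    destruct (H z (fun P HP => HP) (mkposreal eps He)) as [delta Hd].
    exists delta; split; [apply cond_pos |].
    intros w Hw. specialize (Hd w Hw).
    replace (f w - f z - d * (w - z))%C with (f w - f z - (w - z) * d)%C by ring.
    exact Hd.
  - intros H. split.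
    + apply (@is_linear_scal_l C_AbsRing (AbsRing_NormedModule C_AbsRing)).
    + intros x Hx eps.
      apply (is_filter_lim_locally_unique (V := AbsRing_NormedModule C_AbsRing)) in Hx; subst x.
      destruct (H eps (cond_pos eps)) as [delta [Hd0 Hd]].
      exists (mkposreal delta Hd0). intros w Hw.
      specialize (Hd w Hw).
      replace (f w - f z - d * (w - z))%C with (f w - f z - (w - z) * d)%C in Hd by ring.
      exact Hd.
Qed.

(** The remainder of the first-order expansion of [1 / w] at [z] is [(w - z)^2 / (z^2 w)], and
    [|w| >= |z| / 2] near [z]. *)
Lemma is_cderive_Cinv (z : C) : z <> 0 -> is_cderive Cinv z (- / (z * z))%C.
Proof.
  intros Hz. apply is_cderive_eps. intros eps He.
  assert (Hm := proj1 (Cmod_gt_0 z) Hz). set (m := Cmod z) in *.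
  assert (Hm3 : 0 < eps * (m * m * m) / 2).
  { assert (0 < m * m * m) by (repeat apply Rmult_lt_0_compat; lra). nra. }
  exists (Rmin (m / 2) (eps * (m * m * m) / 2)); split.
  { apply Rmin_pos; lra. }
  intros w Hw.
  assert (H1 := Rlt_le_trans _ _ _ Hw (Rmin_l _ _)).
  assert (H2 := Rlt_le_trans _ _ _ Hw (Rmin_r _ _)).
  assert (Hwm : m / 2 <= Cmod w).
  { assert (T := Cmod_triangle w (z - w)). replace (w + (z - w))%C with z in T by ring.
    fold m in T. replace (z - w)%C with (- (w - z))%C in T by ring.
    rewrite Cmod_opp in T. lra. }
  assert (Hw0 : w <> 0) by (apply Cmod_gt_0; lra).
  replace (/ w - / z - - / (z * z) * (w - z))%C
    with ((w - z) * ((w - z) / (z * z * w)))%C by (field; auto).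
  rewrite Cmod_mult, Rmult_comm. apply Rmult_le_compat_r; [apply Cmod_ge_0 |].
  rewrite Cmod_div by (repeat apply Cmult_neq_0; auto).
  rewrite !Cmod_mult. fold m.
  assert (0 < m * m) by nra.
  apply Rle_div_l; [nra |]. nra.
Qed.

Lemma is_cderive_ext (f g : C -> C) (z df dg : C) :
  (forall w, f w = g w) -> df = dg -> is_cderive f z df -> is_cderive g z dg.
Proof. intros H <-. exact (@is_derive_ext C_AbsRing (AbsRing_NormedModule C_AbsRing) f g z df H). Qed.

Lemma is_cderive_mult (f g : C -> C) (z df dg : C) :
  is_cderive f z df -> is_cderive g z dg ->
  is_cderive (fun w => f w * g w)%C z (df * g z + f z * dg)%C.
Proof. intros Hf Hg. exact (is_derive_mult f g z df dg Hf Hg Cmult_comm). Qed.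

Lemma is_cderive_comp (f g : C -> C) (z df dg : C) :
  is_cderive f (g z) df -> is_cderive g z dg ->
  is_cderive (fun w => f (g w)) z (dg * df)%C.
Proof. intros Hf Hg. exact (@is_derive_comp C_AbsRing (AbsRing_NormedModule C_AbsRing) f g z df dg Hf Hg). Qed.

Lemma is_cderive_inv (f : C -> C) (z df : C) :
  is_cderive f z df -> f z <> 0 -> is_cderive (fun w => / f w)%C z (- df / (f z * f z))%C.
Proof.
  intros Hf Hz.
  replace (- df / (f z * f z))%C with (df * - / (f z * f z))%C by (field; auto).
  apply (is_cderive_comp Cinv f); [apply is_cderive_Cinv |]; assumption.
Qed.

Lemma is_cderive_minus (f g : C -> C) (z df dg : C) :
  is_cderive f z df -> is_cderive g z dg -> is_cderive (fun w => f w - g w)%C z (df - dg)%C.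
Proof. exact (@is_derive_minus C_AbsRing (AbsRing_NormedModule C_AbsRing) f g z df dg). Qed.

Lemma is_cderive_const (c z : C) : is_cderive (fun _ => c) z (RtoC 0).
Proof. exact (@is_derive_const C_AbsRing (AbsRing_NormedModule C_AbsRing) c z). Qed.

Lemma is_cderive_id (z : C) : is_cderive (fun w => w) z (RtoC 1).
Proof. exact (@is_derive_id C_AbsRing z). Qed.

Lemma is_cderive_scal (k : C) (f : C -> C) (z df : C) :
  is_cderive f z df -> is_cderive (fun w => k * f w)%C z (k * df)%C.
Proof.
  intros Hf. eapply is_cderive_ext; [reflexivity | | exact (is_cderive_mult _ f z _ df (is_cderive_const k z) Hf)].
  simpl. ring.
Qed.

(** * Goursat's theorem for closed forms in the plane *)

Lemma nested_intervals (u v : nat -> R) :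
  (forall n, u n <= u (S n)) -> (forall n, v (S n) <= v n) -> (forall n, u n <= v n) ->
  exists x, forall n, u n <= x <= v n.
Proof.
  intros Hu Hv Huv.
  assert (Iu : forall n k, u n <= u (n + k)%nat).
  { intros n k; induction k as [|k IH]; [rewrite Nat.add_0_r; lra|].
    rewrite Nat.add_succ_r. specialize (Hu (n + k)%nat). lra. }
  assert (Iv : forall n k, v (n + k)%nat <= v n).
  { intros n k; induction k as [|k IH]; [rewrite Nat.add_0_r; lra|].
    rewrite Nat.add_succ_r. specialize (Hv (n + k)%nat). lra. }
  assert (H : forall m n, u m <= v n).
  { intros m n. apply Rle_trans with (u (m + n)%nat); [apply Iu|].
    apply Rle_trans with (v (n + m)%nat); [|apply Iv].
    rewrite (Nat.add_comm n m). apply Huv. }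
  destruct (completeness (fun r => exists n, r = u n)) as [x [Hx1 Hx2]].
  - exists (v 0%nat). intros r [n ->]. apply H.
  - exists (u 0%nat), 0%nat. reflexivity.
  - exists x. intros n. split.
    + apply Hx1. exists n. reflexivity.
    + apply Hx2. intros r [m ->]. apply H.
Qed.

Lemma pow_half_small (s eps : R) : 0 < eps -> exists n : nat, s * (/ 2) ^ n < eps.
Proof.
  intros He. destruct (Rle_dec s 0) as [Hs | Hs].
  - exists 0%nat. simpl. lra.
  - assert (Hs' : 0 < s) by lra.
    destruct (pow_lt_1_zero (/ 2)) with (y := eps / s) as [N HN].
    + rewrite Rabs_pos_eq; lra.
    + apply Rdiv_lt_0_compat; lra.
    + exists N. specialize (HN N (Nat.le_refl N)).
      rewrite Rabs_pos_eq in HN by (apply pow_le; lra).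
      apply (Rmult_lt_compat_l s) in HN; [|lra].
      replace (s * (eps / s)) with eps in HN by (field; lra). exact HN.
Qed.

(** The subdivision argument of Goursat, for an abstract predicate [B] of bad rectangles: a bad
    rectangle has a bad quarter, the nested bad quarters shrink to a point, and no small rectangle
    containing that point is bad. Restricting the last condition to rectangles that contain the
    point lets differentiability at single points supply it. *)
Lemma rectangle_bisection (B : R -> R -> R -> R -> Prop) (a b c d : R) :
  a <= b -> c <= d ->
  (forall x1 x2 y1 y2, a <= x1 <= x2 -> x2 <= b -> c <= y1 <= y2 -> y2 <= d ->
    let xm := (x1 + x2) / 2 in let ym := (y1 + y2) / 2 in
    B x1 x2 y1 y2 ->
    B x1 xm y1 ym \/ B xm x2 y1 ym \/ B x1 xm ym y2 \/ B xm x2 ym y2) ->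
  (forall x y, a <= x <= b -> c <= y <= d -> exists delta, 0 < delta /\
    forall x1 x2 y1 y2, a <= x1 <= x -> x <= x2 <= b -> c <= y1 <= y -> y <= y2 <= d ->
      x2 - x1 < delta -> y2 - y1 < delta -> ~ B x1 x2 y1 y2) ->
  ~ B a b c d.
Proof.
  intros Hab Hcd Hstep Hloc HB.
  set (inv := fun q : R * R * R * R => let '(x1, x2, y1, y2) := q in
    a <= x1 <= x2 /\ x2 <= b /\ c <= y1 <= y2 /\ y2 <= d /\ B x1 x2 y1 y2).
  set (next := fun q q' : R * R * R * R =>
    let '(x1, x2, y1, y2) := q in let '(x1', x2', y1', y2') := q' in
    inv q' /\ x1 <= x1' /\ x2' <= x2 /\ y1 <= y1' /\ y2' <= y2 /\
    x2' - x1' = (x2 - x1) * / 2 /\ y2' - y1' = (y2 - y1) * / 2).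
  assert (Hnext : forall q, inv q -> exists q', next q q').
  { intros [[[x1 x2] y1] y2] (H1 & H2 & H3 & H4 & H5).
    destruct (Hstep x1 x2 y1 y2 H1 H2 H3 H4 H5) as [H | [H | [H | H]]];
      [ exists (x1, (x1 + x2) / 2, y1, (y1 + y2) / 2)
      | exists ((x1 + x2) / 2, x2, y1, (y1 + y2) / 2)
      | exists (x1, (x1 + x2) / 2, (y1 + y2) / 2, y2)
      | exists ((x1 + x2) / 2, x2, (y1 + y2) / 2, y2) ];
      simpl; repeat split; try assumption; lra. }
  (* [Hnext] only asserts existence, so [epsilon] picks each successive bad quarter; its default
     merely inhabits the type. *)
  set (q := fix q n := match n with
    | O => (a, b, c, d)
    | S n => epsilon (inhabits (a, b, c, d)) (next (q n)) end).
  assert (Hq : forall n, inv (q n)).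
  { induction n as [|n IH].
    - simpl; repeat split; try assumption; lra.
    - assert (E := epsilon_spec (inhabits (a, b, c, d)) _ (Hnext _ IH)).
      change (epsilon (inhabits (a, b, c, d)) (next (q n))) with (q (S n)) in E.
      destruct (q n) as [[[x1 x2] y1] y2], (q (S n)) as [[[x1' x2'] y1'] y2'].
      apply E. }
  assert (Hn : forall n, next (q n) (q (S n))).
  { intros n. exact (epsilon_spec (inhabits (a, b, c, d)) _ (Hnext _ (Hq n))). }
  clearbody q.
  destruct (nested_intervals (fun n => fst (fst (fst (q n)))) (fun n => snd (fst (fst (q n))))) as [x Hx].
  1, 2 : intros n; specialize (Hn n);
    destruct (q n) as [[[x1 x2] y1] y2], (q (S n)) as [[[x1' x2'] y1'] y2']; simpl in *; lra.
  { intros n. specialize (Hq n). destruct (q n) as [[[x1 x2] y1] y2]; simpl in *; lra. }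
  destruct (nested_intervals (fun n => snd (fst (q n))) (fun n => snd (q n))) as [y Hy].
  1, 2 : intros n; specialize (Hn n);
    destruct (q n) as [[[x1 x2] y1] y2], (q (S n)) as [[[x1' x2'] y1'] y2']; simpl in *; lra.
  { intros n. specialize (Hq n). destruct (q n) as [[[x1 x2] y1] y2]; simpl in *; lra. }
  assert (Hsx : forall n, snd (fst (fst (q n))) - fst (fst (fst (q n))) =
     (snd (fst (fst (q O))) - fst (fst (fst (q O)))) * (/ 2) ^ n
     /\ snd (q n) - snd (fst (q n)) = (snd (q O) - snd (fst (q O))) * (/ 2) ^ n).
  { induction n as [|n IH]; [simpl; lra|]. specialize (Hn n).
    destruct (q n) as [[[x1 x2] y1] y2], (q (S n)) as [[[x1' x2'] y1'] y2'].
    simpl in *. destruct IH, Hn as (_ & _ & _ & _ & _ & E1 & E2). split; nra. }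
  assert (Hx0 := Hx O). assert (Hy0 := Hy O).
  assert (Hq0 := Hq O).
  set (sx := snd (fst (fst (q O))) - fst (fst (fst (q O)))) in *.
  set (sy := snd (q O) - snd (fst (q O))) in *.
  assert (Hs0 : 0 <= sx /\ 0 <= sy).
  { unfold sx, sy. destruct (q O) as [[[x1 x2] y1] y2]; simpl in *; lra. }
  destruct (Hloc x y) as [delta [Hd Hnb]].
  1, 2 : destruct (q O) as [[[x1 x2] y1] y2]; simpl in *; lra.
  destruct (pow_half_small (sx + sy) delta Hd) as [n HN].
  specialize (Hq n). specialize (Hsx n). specialize (Hx n). specialize (Hy n).
  assert (Hp : 0 < (/ 2) ^ n) by (apply pow_lt; lra).
  destruct (q n) as [[[x1 x2] y1] y2]; simpl in *.
  apply (Hnb x1 x2 y1 y2); try lra; try apply Hq; nra.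
Qed.

(** * Circulation of a plane one-form around rectangles *)

Lemma differentiable_continuous_l (f : R -> R -> R) (x y lx ly : R) :
  differentiable_pt_lim f x y lx ly -> continuous (fun t => f t y) x.
Proof.
  intros H. apply (ex_derive_continuous (V := R_NormedModule)).
  exists (lx * 1 + ly * 0). apply is_derive_Reals.
  apply (derivable_pt_lim_comp_2d f (fun t => t) (fun _ => y)); [exact H | |].
  - apply derivable_pt_lim_id.
  - apply derivable_pt_lim_const.
Qed.

Lemma differentiable_continuous_r (f : R -> R -> R) (x y lx ly : R) :
  differentiable_pt_lim f x y lx ly -> continuous (fun t => f x t) y.
Proof.
  intros H. apply (ex_derive_continuous (V := R_NormedModule)).
  exists (lx * 0 + ly * 1). apply is_derive_Reals.
  apply (derivable_pt_lim_comp_2d f (fun _ => x) (fun t => t)); [exact H | |].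
  - apply derivable_pt_lim_const.
  - apply derivable_pt_lim_id.
Qed.

(** The max norm of the increment is replaced by any bound [s] on it, so that one [s] serves all
    points of a small rectangle. *)
Lemma differentiable_near (f : R -> R -> R) (x y lx ly eps : R) :
  0 < eps -> differentiable_pt_lim f x y lx ly -> exists delta, 0 < delta /\
  forall s u v, 0 <= s < delta -> Rabs (u - x) <= s -> Rabs (v - y) <= s ->
    Rabs (f u v - f x y - (lx * (u - x) + ly * (v - y))) <= eps * s.
Proof.
  intros He H. destruct (H (mkposreal eps He)) as [delta Hd].
  exists delta. split; [apply cond_pos |]. intros s u v Hs Hu Hv.
  eapply Rle_trans; [apply Hd; lra |]. simpl.
  apply Rmult_le_compat_l; [lra |]. apply Rmax_lub; assumption.
Qed.

Lemma RInt_abs_near_const (f : R -> R) (a b c M : R) :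
  a <= b -> ex_RInt f a b -> (forall t, a <= t <= b -> Rabs (f t - c) <= M) ->
  Rabs (RInt f a b - c * (b - a)) <= M * (b - a).
Proof.
  intros Hab Hf H.
  assert (E : RInt f a b - c * (b - a) = RInt (fun t => f t - c) a b).
  { rewrite (RInt_minus (V := R_CompleteNormedModule) f (fun _ => c));
      [| exact Hf | apply ex_RInt_const].
    rewrite RInt_const. unfold minus, plus, opp, scal; simpl. unfold mult; simpl. ring. }
  rewrite E, Rmult_comm.
  apply (norm_RInt_le_const (V := R_NormedModule) (fun t => f t - c) a b).
  - exact Hab.
  - exact H.
  - apply (RInt_correct (V := R_CompleteNormedModule)).
    apply (ex_RInt_minus (V := R_NormedModule)); [exact Hf | apply ex_RInt_const].
Qed.

(** The integral of [P dx + Q dy] counterclockwise around the rectangle, with opposite sides paired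
    under one integral sign. *)
Definition circulation (P Q : R -> R -> R) (x1 x2 y1 y2 : R) : R :=
  RInt (fun x => P x y1 - P x y2) x1 x2 + RInt (fun y => Q x2 y - Q x1 y) y1 y2.

Section ClosedForm.

Variables (P Q : R -> R -> R) (a b c d : R).
(** The shared [py] expresses closedness, [dP/dy = dQ/dx]; total differentiability at each point
    takes the place of continuous partial derivatives. *)
Hypothesis closed : forall x y, a <= x <= b -> c <= y <= d -> exists px py qy,
  differentiable_pt_lim P x y px py /\ differentiable_pt_lim Q x y py qy.

Lemma ex_RInt_horizontal (x1 x2 y1 y2 : R) :
  a <= x1 <= x2 -> x2 <= b -> c <= y1 <= d -> c <= y2 <= d ->
  ex_RInt (fun x => P x y1 - P x y2) x1 x2.
Proof.
  intros H1 H2 H3 H4. apply (ex_RInt_continuous (V := R_CompleteNormedModule)).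
  rewrite Rmin_left, Rmax_right by lra. intros x Hx.
  apply (continuous_minus (V := R_NormedModule) (fun x => P x y1) (fun x => P x y2)).
  - destruct (closed x y1) as (px & py & qy & HP & _); try lra.
    apply (differentiable_continuous_l _ _ _ _ _ HP).
  - destruct (closed x y2) as (px & py & qy & HP & _); try lra.
    apply (differentiable_continuous_l _ _ _ _ _ HP).
Qed.

Lemma ex_RInt_vertical (x1 x2 y1 y2 : R) :
  a <= x1 <= b -> a <= x2 <= b -> c <= y1 <= y2 -> y2 <= d ->
  ex_RInt (fun y => Q x2 y - Q x1 y) y1 y2.
Proof.
  intros H1 H2 H3 H4. apply (ex_RInt_continuous (V := R_CompleteNormedModule)).
  rewrite Rmin_left, Rmax_right by lra. intros y Hy.
  apply (continuous_minus (V := R_NormedModule) (fun y => Q x2 y) (fun y => Q x1 y)).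
  - destruct (closed x2 y) as (px & py & qy & _ & HQ); try lra.
    apply (differentiable_continuous_r _ _ _ _ _ HQ).
  - destruct (closed x1 y) as (px & py & qy & _ & HQ); try lra.
    apply (differentiable_continuous_r _ _ _ _ _ HQ).
Qed.

(** The two halves traverse their common side in opposite directions, so the terms in [Q xm]
    cancel. *)
Lemma circulation_split_x (x1 xm x2 y1 y2 : R) :
  a <= x1 <= xm -> xm <= x2 <= b -> c <= y1 <= y2 -> y2 <= d ->
  circulation P Q x1 x2 y1 y2 = circulation P Q x1 xm y1 y2 + circulation P Q xm x2 y1 y2.
Proof.
  intros H1 H2 H3 H4. unfold circulation.
  rewrite <- (RInt_Chasles (V := R_CompleteNormedModule) (fun x => P x y1 - P x y2) x1 xm x2)
    by (apply ex_RInt_horizontal; lra).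
  replace (RInt (fun y => Q x2 y - Q x1 y) y1 y2) with
    (RInt (fun y => Q xm y - Q x1 y) y1 y2 + RInt (fun y => Q x2 y - Q xm y) y1 y2).
  - unfold plus; simpl. ring.
  - change (RInt (fun y => Q xm y - Q x1 y) y1 y2 + RInt (fun y => Q x2 y - Q xm y) y1 y2)
      with (plus (RInt (fun y => Q xm y - Q x1 y) y1 y2) (RInt (fun y => Q x2 y - Q xm y) y1 y2)).
    rewrite <- (RInt_plus (V := R_CompleteNormedModule)) by (apply ex_RInt_vertical; lra).
    apply RInt_ext. intros y _. unfold plus; simpl. ring.
Qed.

Lemma circulation_split_y (x1 x2 y1 ym y2 : R) :
  a <= x1 <= x2 -> x2 <= b -> c <= y1 <= ym -> ym <= y2 <= d ->
  circulation P Q x1 x2 y1 y2 = circulation P Q x1 x2 y1 ym + circulation P Q x1 x2 ym y2.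
Proof.
  intros H1 H2 H3 H4. unfold circulation.
  rewrite <- (RInt_Chasles (V := R_CompleteNormedModule) (fun y => Q x2 y - Q x1 y) y1 ym y2)
    by (apply ex_RInt_vertical; lra).
  replace (RInt (fun x => P x y1 - P x y2) x1 x2) with
    (RInt (fun x => P x y1 - P x ym) x1 x2 + RInt (fun x => P x ym - P x y2) x1 x2).
  - unfold plus; simpl. ring.
  - change (RInt (fun x => P x y1 - P x ym) x1 x2 + RInt (fun x => P x ym - P x y2) x1 x2)
      with (plus (RInt (fun x => P x y1 - P x ym) x1 x2) (RInt (fun x => P x ym - P x y2) x1 x2)).
    rewrite <- (RInt_plus (V := R_CompleteNormedModule)) by (apply ex_RInt_horizontal; lra).
    apply RInt_ext. intros y _. unfold plus; simpl. ring.
Qed.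

(** The linear parts of [P] and [Q] at [(x, y)] contribute [py (y1 - y2) (x2 - x1)] and
    [py (x2 - x1) (y2 - y1)], which cancel. What remains is an error of at most [eps / 2 * s] at
    each boundary point, with [s] the half-perimeter. *)
Lemma circulation_small (x y eps : R) :
  0 < eps -> a <= x <= b -> c <= y <= d -> exists delta, 0 < delta /\
  forall x1 x2 y1 y2, a <= x1 <= x -> x <= x2 <= b -> c <= y1 <= y -> y <= y2 <= d ->
    x2 - x1 < delta -> y2 - y1 < delta ->
    Rabs (circulation P Q x1 x2 y1 y2) <= eps * ((x2 - x1) + (y2 - y1)) ^ 2.
Proof.
  intros He Hx Hy. destruct (closed x y Hx Hy) as (px & py & qy & HP & HQ).
  destruct (differentiable_near _ _ _ _ _ (eps / 2) ltac:(lra) HP) as [d1 [Hd1 H1]].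
  destruct (differentiable_near _ _ _ _ _ (eps / 2) ltac:(lra) HQ) as [d2 [Hd2 H2]].
  (* Both sides are shorter than half the minimum, so their sum [s] stays below [d1] and [d2]. *)
  exists (Rmin d1 d2 / 2). split.
  { apply Rdiv_lt_0_compat; [apply Rmin_pos |]; lra. }
  intros x1 x2 y1 y2 Hx1 Hx2 Hy1 Hy2 Hdx Hdy.
  assert (L1 := Rmin_l d1 d2). assert (L2 := Rmin_r d1 d2).
  set (s := (x2 - x1) + (y2 - y1)).
  assert (A : forall u, x1 <= u <= x2 -> Rabs (u - x) <= s)
    by (intros u Hu; unfold s; apply Rabs_le; lra).
  assert (B : forall v, y1 <= v <= y2 -> Rabs (v - y) <= s)
    by (intros u Hu; unfold s; apply Rabs_le; lra).
  assert (Hs : 0 <= s < Rmin d1 d2) by (unfold s; lra).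
  assert (Horiz : Rabs (RInt (fun x => P x y1 - P x y2) x1 x2 - py * (y1 - y2) * (x2 - x1))
            <= eps * s * (x2 - x1)).
  { apply RInt_abs_near_const; [lra | apply ex_RInt_horizontal; lra |].
    intros t Ht.
    assert (K1 := H1 s t y1 ltac:(lra) (A t Ht) (B y1 ltac:(lra))).
    assert (K2 := H1 s t y2 ltac:(lra) (A t Ht) (B y2 ltac:(lra))).
    apply Rabs_le_between in K1; apply Rabs_le_between in K2; apply Rabs_le; lra. }
  assert (Vert : Rabs (RInt (fun y => Q x2 y - Q x1 y) y1 y2 - py * (x2 - x1) * (y2 - y1))
            <= eps * s * (y2 - y1)).
  { apply RInt_abs_near_const; [lra | apply ex_RInt_vertical; lra |].
    intros t Ht.
    assert (K1 := H2 s x1 t ltac:(lra) (A x1 ltac:(lra)) (B t Ht)).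
    assert (K2 := H2 s x2 t ltac:(lra) (A x2 ltac:(lra)) (B t Ht)).
    apply Rabs_le_between in K1; apply Rabs_le_between in K2; apply Rabs_le; lra. }
  unfold circulation.
  replace (eps * s ^ 2) with (eps * s * (x2 - x1) + eps * s * (y2 - y1)) by (unfold s; ring).
  apply Rabs_le_between in Horiz; apply Rabs_le_between in Vert; apply Rabs_le; lra.
Qed.

(** A rectangle counts as bad when its circulation exceeds [eps] times the square of its
    half-perimeter. Quartering divides this threshold by 4, so some quarter of a bad rectangle is
    bad, while [circulation_small] rules out small bad rectangles around any point. *)
Lemma circulation_zero : a <= b -> c <= d -> circulation P Q a b c d = 0.
Proof.
  intros Hab Hcd.
  assert (H : forall eps, 0 < eps ->
    ~ eps * ((b - a) + (d - c)) ^ 2 < Rabs (circulation P Q a b c d)).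
  { intros eps He.
    apply (rectangle_bisection (fun x1 x2 y1 y2 =>
      eps * ((x2 - x1) + (y2 - y1)) ^ 2 < Rabs (circulation P Q x1 x2 y1 y2)) a b c d Hab Hcd).
    - intros x1 x2 y1 y2 Hx1 Hx2 Hy1 Hy2 xm ym HB.
      rewrite (circulation_split_x x1 xm x2) in HB by (unfold xm; lra).
      rewrite (circulation_split_y x1 xm y1 ym y2), (circulation_split_y xm x2 y1 ym y2) in HB
        by (unfold xm, ym; lra).
      set (s := (x2 - x1) + (y2 - y1)) in HB.
      replace (xm - x1 + (ym - y1)) with (s / 2) by (unfold s, xm, ym; field).
      replace (x2 - xm + (ym - y1)) with (s / 2) by (unfold s, xm, ym; field).
      replace (xm - x1 + (y2 - ym)) with (s / 2) by (unfold s, xm, ym; field).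
      replace (x2 - xm + (y2 - ym)) with (s / 2) by (unfold s, xm, ym; field).
      replace (eps * (s / 2) ^ 2) with (eps * s ^ 2 / 4) by field.
      match type of HB with _ < Rabs (?A + ?B + (?C + ?D)) =>
        assert (T1 := Rabs_triang (A + B) (C + D)); assert (T2 := Rabs_triang A B);
        assert (T3 := Rabs_triang C D);
        destruct (Rlt_le_dec (eps * s ^ 2 / 4) (Rabs A)); [tauto |];
        destruct (Rlt_le_dec (eps * s ^ 2 / 4) (Rabs B)); [tauto |];
        destruct (Rlt_le_dec (eps * s ^ 2 / 4) (Rabs C)); [tauto |];
        destruct (Rlt_le_dec (eps * s ^ 2 / 4) (Rabs D)); [tauto |]
      end; lra.
    - intros x y Hx Hy. destruct (circulation_small x y eps He Hx Hy) as [delta [Hd Hs]].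
      exists delta. split; [exact Hd |]. intros x1 x2 y1 y2 K1 K2 K3 K4 K5 K6.
      specialize (Hs x1 x2 y1 y2 K1 K2 K3 K4 K5 K6). lra. }
  destruct (Req_dec (circulation P Q a b c d) 0) as [E | E]; [exact E | exfalso].
  assert (Hp := Rabs_pos_lt _ E). set (m := Rabs (circulation P Q a b c d)) in *.
  set (s := (b - a) + (d - c)) in *. assert (0 <= s) by (unfold s; lra).
  assert (Hm : 0 < 2 * (s ^ 2 + 1)) by nra.
  (* This [eps] makes [eps * s ^ 2 < m]; the summand 1 covers [s = 0]. *)
  apply (H (m / (2 * (s ^ 2 + 1)))); [apply Rdiv_lt_0_compat; lra |].
  assert (E2 : m / (2 * (s ^ 2 + 1)) * s ^ 2 = m * (s ^ 2 / (2 * (s ^ 2 + 1)))) by (field; nra).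
  rewrite E2. assert (s ^ 2 / (2 * (s ^ 2 + 1)) < 1) by (apply Rlt_div_l; nra). nra.
Qed.

End ClosedForm.

(** * The Schwarz lemma at the origin *)

Lemma differentiable_mult (x y : R) : differentiable_pt_lim Rmult x y y x.
Proof.
  intros eps. exists eps. intros u v Hu Hv.
  replace (u * v - x * y - (y * (u - x) + x * (v - y))) with ((v - y) * (u - x)) by ring.
  rewrite Rabs_mult. apply Rmult_le_compat; try apply Rabs_pos; [lra | apply Rmax_l].
Qed.

Lemma differentiable_proj2 (f : R -> R) (x y l : R) :
  derivable_pt_lim f y l -> differentiable_pt_lim (fun _ v => f v) x y 0 l.
Proof.
  intros H.
  assert (I : differentiable_pt_lim (fun _ v => v) x y 0 1).
  { intros eps. exists eps. intros u v Hu Hv.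
    replace (v - y - (0 * (u - x) + 1 * (v - y))) with 0 by ring. rewrite Rabs_R0.
    apply Rmult_le_pos; [apply Rlt_le, cond_pos |].
    apply Rle_trans with (1 := Rabs_pos (u - x)), Rmax_l. }
  assert (K := differentiable_pt_lim_comp (fun u _ => f u) (fun _ v => v) (fun _ v => v)
    x y l 0 0 1 0 1 (differentiable_pt_lim_proj1_0 f y y l H) I I).
  replace 0 with (l * 0 + 0 * 0) by ring. replace l with (l * 1 + 0 * 1) at 2 by ring. exact K.
Qed.

Lemma differentiable_separated (f g : R -> R) (x y lf lg : R) :
  derivable_pt_lim f x lf -> derivable_pt_lim g y lg ->
  differentiable_pt_lim (fun u v => f u * g v) x y (lf * g y) (f x * lg).
Proof.
  intros Hf Hg.
  assert (K := differentiable_pt_lim_comp Rmult (fun u _ => f u) (fun _ v => g v) x y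
    _ _ _ _ _ _ (differentiable_mult (f x) (g y))
    (differentiable_pt_lim_proj1_0 f x y lf Hf) (differentiable_proj2 g x y lg Hg)).
  replace (lf * g y) with (g y * lf + f x * 0) by ring.
  replace (f x * lg) with (g y * 0 + f x * lg) by ring. exact K.
Qed.

Lemma im_le_Cmod (z : C) : Rabs (Im z) <= Cmod z.
Proof. eapply Rle_trans; [apply Rmax_r | apply Rmax_Cmod]. Qed.

(** Complex derivatives are measured by [Cmod] and [differentiable_pt_lim] by the max norm; the
    factor [sqrt 2 <= 2] between them is absorbed by halving [eps]. *)
Lemma Cmod_le_eps_Rmax (z : C) (u v : R) (eps : R) :
  0 <= eps -> Cmod z <= eps / 2 * Cmod (u, v) -> Cmod z <= eps * Rmax (Rabs u) (Rabs v).
Proof.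
  intros He H. eapply Rle_trans; [exact H |].
  assert (S := Cmod_2Rmax (u, v)). simpl in S.
  assert (S2 : sqrt 2 <= 2) by (apply Rsqr_incr_0_var; [rewrite Rsqr_sqrt; unfold Rsqr |]; lra).
  assert (M : 0 <= Rmax (Rabs u) (Rabs v)).
  { apply Rle_trans with (1 := Rabs_pos u), Rmax_l. }
  assert (Cmod (u, v) <= 2 * Rmax (Rabs u) (Rabs v)) by nra. nra.
Qed.

(** The Cauchy-Riemann equations: multiplication by [d] is the real matrix with rows
    [(Re d, - Im d)] and [(Im d, Re d)]. *)
Lemma is_cderive_differentiable (h : C -> C) (x y : R) (d : C) :
  is_cderive h (x, y) d ->
  differentiable_pt_lim (fun u v => Re (h (u, v))) x y (Re d) (- Im d) /\
  differentiable_pt_lim (fun u v => Im (h (u, v))) x y (Im d) (Re d).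
Proof.
  intros H. rewrite is_cderive_eps in H.
  assert (K : forall eps : posreal, exists delta : posreal, forall u v,
    Rabs (u - x) < delta -> Rabs (v - y) < delta ->
    Cmod (h (u, v) - h (x, y) - d * ((u, v) - (x, y)))%C
      <= eps * Rmax (Rabs (u - x)) (Rabs (v - y))).
  { intros eps. destruct (H (eps / 2)) as [delta [Hd Hde]].
    { apply Rdiv_lt_0_compat; [apply cond_pos | lra]. }
    exists (mkposreal (delta / 2) ltac:(lra)). simpl. intros u v Hu Hv.
    apply Cmod_le_eps_Rmax; [apply Rlt_le, cond_pos |].
    change (u - x, v - y) with ((u, v) - (x, y))%C. apply Hde.
    assert (S := Cmod_2Rmax ((u, v) - (x, y))%C). simpl in S.
    assert (S2 : sqrt 2 <= 2) by (apply Rsqr_incr_0_var; [rewrite Rsqr_sqrt; unfold Rsqr |]; lra).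
    assert (M := Rmax_lub_lt _ _ _ Hu Hv).
    assert (M0 : 0 <= Rmax (Rabs (u - x)) (Rabs (v - y))).
    { apply Rle_trans with (1 := Rabs_pos (u - x)), Rmax_l. }
    unfold Rminus in *. nra. }
  split; intros eps; destruct (K eps) as [delta Hd]; exists delta; intros u v Hu Hv;
    (eapply Rle_trans; [| exact (Hd u v Hu Hv)]).
  - eapply Rle_trans; [| apply re_le_Cmod]. apply Req_le. f_equal. unfold Re, Im. destruct d; simpl. ring.
  - eapply Rle_trans; [| apply im_le_Cmod]. apply Req_le. f_equal. unfold Re, Im. destruct d; simpl. ring.
Qed.

(** This is [e^(x+iy)]: vertical segments of length [2 PI] become circles about 0, and an annulus
    pulls back to a rectangle. *)
Definition polar (x y : R) : C := (exp x * cos y, exp x * sin y).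

Lemma Cmod_polar (x y : R) : Cmod (polar x y) = exp x.
Proof.
  unfold Cmod, polar; simpl fst; simpl snd.
  replace ((exp x * cos y) ^ 2 + (exp x * sin y) ^ 2)
    with (exp x ^ 2 * (Rsqr (sin y) + Rsqr (cos y))) by (unfold Rsqr; ring).
  rewrite sin2_cos2, Rmult_1_r. apply sqrt_pow2, Rlt_le, exp_pos.
Qed.

(* In the coordinates z = e^(x+iy), the form Im (h (z) dz / z) = Im h dx + Re h dy
   is closed and 2 pi-periodic in y, so the two horizontal sides cancel. *)
Lemma circle_mean_const (h : C -> C) (x1 x2 : R) :
  x1 <= x2 -> (forall z, exp x1 <= Cmod z <= exp x2 -> exists d, is_cderive h z d) ->
  RInt (fun y => Re (h (polar x1 y))) 0 (2 * PI) = RInt (fun y => Re (h (polar x2 y))) 0 (2 * PI)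
  /\ ex_RInt (fun y => Re (h (polar x1 y))) 0 (2 * PI)
  /\ ex_RInt (fun y => Re (h (polar x2 y))) 0 (2 * PI).
Proof.
  intros Hx Hh. assert (Hpi := PI_RGT_0).
  set (Q := fun x y => Re (h (polar x y))). set (P := fun x y => Im (h (polar x y))).
  assert (closed : forall x y, x1 <= x <= x2 -> 0 <= y <= 2 * PI -> exists px py qy,
    differentiable_pt_lim P x y px py /\ differentiable_pt_lim Q x y py qy).
  { intros x y Hx12 _. destruct (Hh (polar x y)) as [d Hd].
    { rewrite Cmod_polar. assert (M : forall s t, s <= t -> exp s <= exp t).
      { intros s t [Hst | ->]; [apply Rlt_le, exp_increasing, Hst | lra]. }
      split; apply M; lra. }
    destruct (is_cderive_differentiable _ _ _ _ Hd) as [HR HI].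
    assert (DX := differentiable_separated exp cos x y _ _
      (derivable_pt_lim_exp x) (derivable_pt_lim_cos y)).
    assert (DY := differentiable_separated exp sin x y _ _
      (derivable_pt_lim_exp x) (derivable_pt_lim_sin y)).
    assert (DQ := differentiable_pt_lim_comp _ _ _ _ _ _ _ _ _ _ _ HR DX DY).
    assert (DP := differentiable_pt_lim_comp _ _ _ _ _ _ _ _ _ _ _ HI DX DY).
    eexists _, _, _. split; [exact DP |].
    replace (Im d * (exp x * - sin y) + Re d * (exp x * cos y))
      with (Re d * (exp x * cos y) + - Im d * (exp x * sin y)) by ring.
    exact DQ. }
  assert (Z := circulation_zero P Q x1 x2 0 (2 * PI) closed Hx ltac:(lra)).
  assert (X : forall x, x1 <= x <= x2 -> ex_RInt (Q x) 0 (2 * PI)).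
  { intros x Hx12. apply (ex_RInt_continuous (V := R_CompleteNormedModule)).
    rewrite Rmin_left, Rmax_right by lra. intros y Hy.
    destruct (closed x y Hx12 Hy) as (px & py & qy & _ & D).
    apply (differentiable_continuous_r _ _ _ _ _ D). }
  unfold circulation in Z.
  rewrite (RInt_ext (V := R_CompleteNormedModule) _ (fun _ => 0)) in Z.
  2:{ intros x _. unfold P, polar. rewrite cos_2PI, sin_2PI, cos_0, sin_0. apply Rminus_diag_eq. reflexivity. }
  rewrite RInt_const in Z.
  rewrite (RInt_minus (V := R_CompleteNormedModule) (Q x2) (Q x1)) in Z by (apply X; lra).
  unfold minus, plus, opp, scal in Z; simpl in Z. unfold mult in Z; simpl in Z.
  repeat split; [| apply X; lra | apply X; lra]. unfold Q in Z. lra.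
Qed.

(** The integral of [Re (k z / z)] is the same on all circles about 0. On a small circle the
    integrand is at least [Re d - e]; on the circle of radius [1 / (1 + e)] it is at most [1 + e].
    If [Re d = 1 + 3 e] with [e > 0], these bounds are incompatible. *)
Lemma schwarz_re_deriv (k : C -> C) (d : C) :
  (forall z : C, Cmod z < 1 -> Cmod (k z) <= 1 /\ exists dk, is_cderive k z dk) ->
  k 0 = 0 -> is_cderive k 0 d -> Re d <= 1.
Proof.
  intros Hk Hk0 Hd. apply Rnot_lt_le. intros Hlt.
  set (e := (Re d - 1) / 3). assert (He : 0 < e) by (unfold e; lra).
  rewrite is_cderive_eps in Hd. destruct (Hd e He) as [delta [Hdp Hde]].
  set (x2 := - ln (1 + e)).
  assert (Hx2 : exp x2 < 1).
  { rewrite <- exp_0. apply exp_increasing. unfold x2.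
    assert (L := ln_increasing 1 (1 + e)). rewrite ln_1 in L. lra. }
  (* The inner radius is at most [delta / 2]; the minimum with [x2] keeps the inner circle within
     the outer one. *)
  set (x1 := Rmin (ln (delta / 2)) x2).
  assert (Hx1 : exp x1 < delta).
  { apply Rle_lt_trans with (exp (ln (delta / 2))).
    - destruct (Rmin_l (ln (delta / 2)) x2) as [L | E]; unfold x1.
      + apply Rlt_le, exp_increasing, L.
      + rewrite E. lra.
    - rewrite exp_ln; lra. }
  assert (Hpi := PI_RGT_0).
  destruct (circle_mean_const (fun z => (k z / z)%C) x1 x2) as (E & I1 & I2).
  { apply Rmin_r. }
  { intros z Hz. assert (H1 := exp_pos x1).
    destruct (Hk z) as [_ [dk Hdk]]; [lra |].
    eexists. apply is_cderive_mult; [exact Hdk |].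
    apply is_cderive_Cinv, Cmod_gt_0. lra. }
  assert (L : RInt (fun y => Re d - e) 0 (2 * PI) <= RInt (fun y => Re (k (polar x1 y) / polar x1 y)%C) 0 (2 * PI)).
  { apply RInt_le; [lra | apply ex_RInt_const | exact I1 |]. intros y _.
    set (z := polar x1 y). assert (Hz : Cmod z = exp x1) by apply Cmod_polar.
    assert (Hp := exp_pos x1). assert (Hz0 : z <> 0) by (apply Cmod_gt_0; lra).
    specialize (Hde z). replace (z - 0)%C with z in Hde by ring.
    rewrite Hk0 in Hde. specialize (Hde ltac:(lra)).
    assert (B : Cmod (k z / z - d)%C <= e).
    { replace (k z / z - d)%C with ((k z - 0 - d * z) / z)%C by (field; auto).
      rewrite Cmod_div by auto. apply Rle_div_l; lra. }
    assert (Rb := re_le_Cmod (k z / z - d)%C).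
    assert (Q := Rle_trans _ _ _ Rb B). apply Rabs_le_between in Q.
    destruct (k z / z)%C, d; simpl in *. lra. }
  assert (U : RInt (fun y => Re (k (polar x2 y) / polar x2 y)%C) 0 (2 * PI) <= RInt (fun y => 1 + e) 0 (2 * PI)).
  { apply RInt_le; [lra | exact I2 | apply ex_RInt_const |]. intros y _.
    set (z := polar x2 y). assert (Hz : Cmod z = exp x2) by apply Cmod_polar.
    assert (Hp := exp_pos x2). assert (Hz0 : z <> 0) by (apply Cmod_gt_0; lra).
    destruct (Hk z) as [B _]; [lra |].
    eapply Rle_trans; [apply Rle_abs |]. eapply Rle_trans; [apply re_le_Cmod |].
    rewrite Cmod_div, Hz by auto. apply Rle_div_l; [lra |].
    unfold x2. rewrite exp_Ropp, exp_ln by lra.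
    rewrite Rinv_r by lra. exact B. }
  rewrite RInt_const in L, U.
  change (scal (2 * PI - 0) (Re d - e)) with ((2 * PI - 0) * (Re d - e)) in L.
  change (scal (2 * PI - 0) (1 + e)) with ((2 * PI - 0) * (1 + e)) in U.
  cbv beta in E. rewrite E in L.
  assert (T := Rle_trans _ _ _ L U). assert (0 < PI * e) by (apply Rmult_lt_0_compat; lra).
  replace (Re d) with (1 + 3 * e) in T by (unfold e; field). nra.
Qed.

(** Multiplying [k] by the phase [c] that turns [d] into [|d|] reduces the modulus to a real
    part. *)
Lemma schwarz_deriv (k : C -> C) (d : C) :
  (forall z : C, Cmod z < 1 -> Cmod (k z) <= 1 /\ exists dk, is_cderive k z dk) ->
  k 0 = 0 -> is_cderive k 0 d -> Cmod d <= 1.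
Proof.
  intros Hk Hk0 Hd. destruct (Req_dec (Cmod d) 0) as [E | E]; [lra |].
  set (c := (Cconj d / Cmod d)%C).
  assert (Ed : RtoC (Cmod d) <> 0) by (intros H; apply RtoC_inj in H; auto).
  assert (Hc : Cmod c = 1).
  { unfold c. rewrite Cmod_div, Cmod_conj, Cmod_R, Rabs_pos_eq by (auto; apply Cmod_ge_0). field; auto. }
  replace (Cmod d) with (Re (c * d)%C).
  - apply (schwarz_re_deriv (fun z => c * k z)%C).
    + intros z Hz. destruct (Hk z Hz) as [B [dk Hdk]]. split.
      * rewrite Cmod_mult, Hc. lra.
      * eexists. apply is_cderive_scal, Hdk.
    + rewrite Hk0. ring.
    + apply is_cderive_scal, Hd.
  - unfold c. replace (Cconj d / Cmod d * d)%C with (d * Cconj d / Cmod d)%C by (field; auto).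
    rewrite <- Cmod2_conj. rewrite <- RtoC_div by auto. simpl. field; auto.
Qed.

(** * The Schwarz-Pick lemma *)

Lemma one_minus_neq_0 (z : C) : Cmod z < 1 -> (1 - z)%C <> 0.
Proof.
  intros Hz H. apply (Rlt_irrefl 1). rewrite <- Cmod_1 at 1.
  replace (RtoC 1) with z; [exact Hz |]. replace z with (1 - (1 - z))%C by ring. rewrite H. ring.
Qed.

Lemma unimodular_phase (z : C) : exists c : C, Cmod c = 1 /\ z = (c * Cmod z)%C.
Proof.
  destruct (Req_dec (Cmod z) 0) as [E | E].
  - exists (RtoC 1). split; [apply Cmod_1 |].
    rewrite E, (Cmod_eq_0 _ E). ring.
  - assert (E' : RtoC (Cmod z) <> 0) by (intros H; apply RtoC_inj in H; auto).
    exists (z / Cmod z)%C. split; [| field; exact E'].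
    rewrite Cmod_div, Cmod_R, Rabs_pos_eq by (auto; apply Cmod_ge_0). field; exact E.
Qed.

(** For [|a| < 1] this is the disc automorphism taking [a] to 0, with inverse [blaschke (- a)];
    [mobius_dist l m] is the modulus of [blaschke m l]. *)
Definition blaschke (a z : C) : C := ((z - a) / (1 - Cconj a * z))%C.

Lemma blaschke_denom (a z : C) :
  Cmod a < 1 -> Cmod z < 1 -> (1 - Cconj a * z)%C <> 0.
Proof.
  intros Ha Hz. apply one_minus_neq_0. rewrite Cmod_mult, Cmod_conj.
  assert (H1 := Cmod_ge_0 a). assert (H2 := Cmod_ge_0 z). nra.
Qed.

Lemma blaschke_disc (a z : C) : Cmod a < 1 -> Cmod z < 1 -> Cmod (blaschke a z) < 1.
Proof.
  intros Ha Hz. unfold blaschke. assert (Hd := blaschke_denom a z Ha Hz).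
  rewrite Cmod_div by exact Hd. assert (Hp := proj1 (Cmod_gt_0 _) Hd).
  apply Rlt_div_l; [exact Hp |]. rewrite Rmult_1_l.
  assert (E : Cmod (1 - Cconj a * z)%C ^ 2 - Cmod (z - a)%C ^ 2
    = (1 - Cmod a ^ 2) * (1 - Cmod z ^ 2)).
  { rewrite !Cmod2_alt. unfold Re, Im. destruct a, z; simpl. ring. }
  assert (H1 := Cmod_ge_0 a). assert (H2 := Cmod_ge_0 z). assert (H3 := Cmod_ge_0 (z - a)%C).
  assert (0 < (1 - Cmod a ^ 2) * (1 - Cmod z ^ 2)) by (apply Rmult_lt_0_compat; nra).
  nra.
Qed.

Lemma is_cderive_blaschke (a z : C) :
  Cmod a < 1 -> Cmod z < 1 ->
  is_cderive (blaschke a) z ((1 - Cmod a ^ 2)%R / ((1 - Cconj a * z) * (1 - Cconj a * z)))%C.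
Proof.
  intros Ha Hz. assert (Hd := blaschke_denom a z Ha Hz).
  eapply is_cderive_ext; [reflexivity | |
    apply (is_cderive_mult (fun w => w - a)%C (fun w => / (1 - Cconj a * w))%C);
    [ apply is_cderive_minus; [apply is_cderive_id | apply is_cderive_const]
    | apply (is_cderive_inv (fun w => 1 - Cconj a * w)%C);
      [apply is_cderive_minus; [apply is_cderive_const |
        apply is_cderive_scal, is_cderive_id] | exact Hd]]].
  rewrite RtoC_minus, Cmod2_conj. field. exact Hd.
Qed.

(** Composing [g] with an automorphism taking 0 to [t] before and one taking [g t] to 0 after gives
    a map to which [schwarz_deriv] applies at 0. *)
Lemma schwarz_pick_deriv (g : C -> C) (t dg : C) :
  (forall z : C, Cmod z < 1 -> Cmod (g z) < 1 /\ exists d, is_cderive g z d) ->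
  Cmod t < 1 -> is_cderive g t dg -> Cmod dg * (1 - Cmod t ^ 2) <= 1 - Cmod (g t) ^ 2.
Proof.
  intros Hg Ht Hdg.
  assert (Ht' : Cmod (- t)%C < 1) by (rewrite Cmod_opp; exact Ht).
  assert (H0 : Cmod 0 < 1) by (rewrite Cmod_0; lra).
  assert (E0 : blaschke (- t) 0 = t).
  { unfold blaschke. rewrite Copp_conj. field. }
  assert (Hgt := proj1 (Hg t Ht)).
  assert (Hd := blaschke_denom (g t) (g t) Hgt Hgt).
  assert (P1 : 0 < 1 - Cmod t ^ 2) by (assert (Q := Cmod_ge_0 t); nra).
  assert (P2 : 0 < 1 - Cmod (g t) ^ 2) by (assert (Q := Cmod_ge_0 (g t)); nra).
  assert (D1 := is_cderive_blaschke (- t) 0 Ht' H0).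
  rewrite <- E0 in Hdg.
  assert (D2 := is_cderive_comp g (blaschke (- t)) 0 _ _ Hdg D1).
  assert (D3 := is_cderive_comp (blaschke (g t)) (fun z => g (blaschke (- t) z)) 0 _ _
    ltac:(cbv beta; rewrite E0; exact (is_cderive_blaschke (g t) (g t) Hgt Hgt)) D2).
  apply schwarz_deriv in D3.
  - rewrite !Cmod_mult, !Cmod_div in D3.
    2:{ apply Cmult_neq_0; exact Hd. }
    2:{ replace ((1 - Cconj (- t) * 0) * (1 - Cconj (- t) * 0))%C with (RtoC 1) by ring.
        intros H. apply RtoC_inj in H. lra. }
    replace (1 - Cconj (g t) * g t)%C with (RtoC (1 - Cmod (g t) ^ 2)) in D3.
    2:{ rewrite RtoC_minus, Cmod2_conj. ring. }
    replace ((1 - Cconj (- t) * 0) * (1 - Cconj (- t) * 0))%C with (RtoC 1) in D3 by ring.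
    rewrite Cmod_opp, !Cmod_mult, !Cmod_R in D3.
    rewrite (Rabs_pos_eq 1), (Rabs_pos_eq (1 - Cmod t ^ 2)), (Rabs_pos_eq (1 - Cmod (g t) ^ 2)) in D3 by lra.
    replace ((1 - Cmod t ^ 2) / 1 * Cmod dg *
      ((1 - Cmod (g t) ^ 2) / ((1 - Cmod (g t) ^ 2) * (1 - Cmod (g t) ^ 2))))
      with ((Cmod dg * (1 - Cmod t ^ 2)) / (1 - Cmod (g t) ^ 2)) in D3 by (field; lra).
    apply Rle_div_l in D3; lra.
  - intros z Hz. assert (Hb := blaschke_disc (- t) z Ht' Hz).
    destruct (Hg _ Hb) as [B [d Hd']]. split.
    + apply Rlt_le, blaschke_disc; assumption.
    + eexists. apply (is_cderive_comp (blaschke (g t)) (fun z => g (blaschke (- t) z))).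
      * apply is_cderive_blaschke; assumption.
      * apply (is_cderive_comp g (blaschke (- t)));
          [exact Hd' | apply is_cderive_blaschke; assumption].
  - cbv beta. rewrite E0. unfold blaschke, Cdiv. ring.
Qed.

(** * The inverse hyperbolic tangent and the integrated Schwarz-Pick inequality *)

Lemma is_derive_atanh (u : R) : -1 < u < 1 -> is_derive atanh u (/ (1 - u ^ 2)).
Proof.
  intros Hu. unfold atanh. auto_derive.
  - repeat split; try lra. apply Rdiv_lt_0_compat; lra.
  - field. repeat split; nra.
Qed.

Lemma atanh_opp (u : R) : -1 < u < 1 -> atanh (- u) = - atanh u.
Proof.
  intros Hu. unfold atanh.
  replace ((1 + - u) / (1 - - u)) with (/ ((1 + u) / (1 - u))) by (field; lra).
  rewrite ln_Rinv by (apply Rdiv_lt_0_compat; lra). ring.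
Qed.

Lemma atanh_0 : atanh 0 = 0.
Proof. unfold atanh. replace ((1 + 0) / (1 - 0)) with 1 by field. rewrite ln_1. ring. Qed.

Lemma atanh_le (u v : R) : -1 < u <= v -> v < 1 -> atanh u <= atanh v.
Proof.
  intros Hu Hv. unfold atanh. apply Rmult_le_compat_l; [lra |].
  apply ln_le; [apply Rdiv_lt_0_compat; lra |].
  apply Rle_div_l; [lra |].
  replace ((1 + v) / (1 - v) * (1 - u)) with ((1 + v) * (1 - u) / (1 - v)) by (field; lra).
  apply Rle_div_r; [lra |]. nra.
Qed.

(** By the infinitesimal bound, [atanh (Re (g t)) - atanh t] has nonpositive derivative on [[0, s]];
    the mean value theorem concludes. *)
Lemma atanh_re_real_segment (g : C -> C) (s : R) :
  (forall z : C, Cmod z < 1 -> Cmod (g z) < 1 /\ exists d, is_cderive g z d) ->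
  0 <= s < 1 -> atanh (Re (g s)) - atanh (Re (g 0)) <= atanh s.
Proof.
  intros Hg Hs.
  assert (Hre : forall z : C, Cmod z < 1 -> -1 < Re (g z) < 1).
  { intros z Hz. assert (R1 := re_le_Cmod (g z)). assert (R2 := proj1 (Hg z Hz)).
    apply Rabs_le_between in R1. lra. }
  assert (Hdisc : forall t, 0 <= t <= s -> Cmod t < 1).
  { intros t Ht. rewrite Cmod_R, Rabs_pos_eq; lra. }
  assert (D : forall t, 0 <= t <= s -> exists d, d <= 0 /\
    is_derive (fun t : R => atanh (Re (g t)) - atanh t) t d).
  { intros t Ht. destruct (Hg _ (Hdisc t Ht)) as [_ [dg Hdg]].
    assert (Hu := Hre _ (Hdisc t Ht)).
    assert (Du : is_derive (fun t : R => Re (g t)) t (Re dg)).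
    { destruct (is_cderive_differentiable g t 0 dg Hdg) as [HR _].
      apply is_derive_Reals.
      assert (K := derivable_pt_lim_comp_2d (fun u v => Re (g (u, v))) (fun t => t) (fun _ => 0)
        t _ _ 1 0 HR (derivable_pt_lim_id t) (derivable_pt_lim_const 0 t)).
      replace (Re dg) with (Re dg * 1 + - Im dg * 0) by ring. exact K. }
    exists (Re dg * / (1 - Re (g t) ^ 2) - / (1 - t ^ 2)). split.
    (* |Re g'| / (1 - (Re g)^2) <= |g'| / (1 - |g|^2), so real parts suffice. *)
    - assert (SP := schwarz_pick_deriv g t dg Hg (Hdisc t Ht) Hdg).
      rewrite (Cmod_R t), Rabs_pos_eq in SP by lra.
      assert (R1 := re_le_Cmod dg). assert (R1' := Rle_abs (Re dg)).
      assert (R2 : Re (g t) ^ 2 <= Cmod (g t) ^ 2) by (rewrite Cmod2_alt; nra).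
      assert (P1 : 0 < 1 - t ^ 2) by nra. assert (P2 : 0 < 1 - Re (g t) ^ 2) by nra.
      apply Rle_minus. apply Rle_div_l; [exact P2 |].
      rewrite Rmult_comm. apply Rle_div_r; [exact P1 |]. nra.
    - apply (is_derive_minus (V := R_NormedModule) (fun t : R => atanh (Re (g t))) atanh).
      + apply (is_derive_comp (V := R_NormedModule) atanh (fun t : R => Re (g t))); [apply is_derive_atanh, Hu | exact Du].
      + apply is_derive_atanh. lra. }
  set (f := fun t : R => atanh (Re (g t)) - atanh t) in D.
  destruct (MVT_gen f 0 s (fun t => Derive f t)) as [c [Hc E]].
  - rewrite Rmin_left, Rmax_right by lra. intros t Ht.
    destruct (D t ltac:(lra)) as [d [_ Hd]]. apply Derive_correct. exists d. exact Hd.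
  - rewrite Rmin_left, Rmax_right by lra. intros t Ht.
    destruct (D t ltac:(lra)) as [d [_ Hd]]. apply continuity_pt_filterlim.
    apply (ex_derive_continuous (V := R_NormedModule)). exists d. exact Hd.
  - rewrite Rmin_left, Rmax_right in Hc by lra.
    destruct (D c ltac:(lra)) as [d [Hd0 Hd]]. cbv beta in E.
    rewrite (is_derive_unique _ _ _ Hd) in E. unfold f in E. rewrite atanh_0 in E. nra.
Qed.

Lemma mobius_dist_lt_1 (l m : C) : Cmod l < 1 -> Cmod m < 1 -> 0 <= mobius_dist l m < 1.
Proof. intros Hl Hm. split; [apply Cmod_ge_0 | apply (blaschke_disc m l Hm Hl)]. Qed.

(** The automorphism [z |-> blaschke (- m) (c z)] takes 0 to [m] and the real number
    [mobius_dist l m] to [l], which reduces the claim to a real segment. *)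
Lemma atanh_re_le (g : C -> C) (l m : C) :
  (forall z : C, Cmod z < 1 -> Cmod (g z) < 1 /\ exists d, is_cderive g z d) ->
  Cmod l < 1 -> Cmod m < 1 ->
  atanh (Re (g l)) - atanh (Re (g m)) <= atanh (mobius_dist l m).
Proof.
  intros Hg Hl Hm. assert (Hs := mobius_dist_lt_1 l m Hl Hm).
  destruct (unimodular_phase (blaschke m l)) as [c [Hc E]].
  change (Cmod (blaschke m l)) with (mobius_dist l m) in E. set (s := mobius_dist l m) in *.
  assert (Hm' : Cmod (- m)%C < 1) by (rewrite Cmod_opp; exact Hm).
  assert (Hcz : forall z : C, Cmod z < 1 -> Cmod (c * z)%C < 1).
  { intros z Hz. rewrite Cmod_mult, Hc. lra. }
  assert (K := atanh_re_real_segment (fun z => g (blaschke (- m) (c * z)))%C s).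
  cbv beta in K. rewrite <- E in K.
  replace (blaschke (- m) (blaschke m l)) with l in K.
  2:{ unfold blaschke. rewrite Copp_conj.
      assert (H1 := blaschke_denom m l Hm Hl). assert (H2 := blaschke_denom m m Hm Hm).
      field. split; [exact H1 |]. intros H. apply H2. ring_simplify in H. rewrite <- H. ring. }
  replace (blaschke (- m) (c * 0)) with m in K.
  2:{ unfold blaschke. rewrite Copp_conj. field. }
  apply K; [| lra]. intros z Hz.
  assert (Hb := blaschke_disc (- m) (c * z) Hm' (Hcz z Hz)).
  destruct (Hg _ Hb) as [B [d Hd]]. split; [exact B |]. eexists.
  apply (is_cderive_comp g (fun z => blaschke (- m) (c * z))%C); [exact Hd |].
  apply (is_cderive_comp (blaschke (- m)) (fun z => c * z)%C).
  - apply is_cderive_blaschke; auto.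
  - apply is_cderive_scal, is_cderive_id.
Qed.

(** The other sign comes from [- g], since [atanh] is odd. *)
Lemma atanh_re_abs_le (g : C -> C) (l m : C) :
  (forall z : C, Cmod z < 1 -> Cmod (g z) < 1 /\ exists d, is_cderive g z d) ->
  Cmod l < 1 -> Cmod m < 1 ->
  Rabs (atanh (Re (g l)) - atanh (Re (g m))) <= atanh (mobius_dist l m).
Proof.
  intros Hg Hl Hm.
  assert (Hre : forall z : C, Cmod z < 1 -> -1 < Re (g z) < 1).
  { intros z Hz. assert (R1 := re_le_Cmod (g z)). assert (R2 := proj1 (Hg z Hz)).
    apply Rabs_le_between in R1. lra. }
  assert (K1 := atanh_re_le g l m Hg Hl Hm).
  assert (K2 := atanh_re_le (fun z => (-1) * g z)%C l m).
  cbv beta in K2.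
  assert (Ere : forall z, Re ((-1) * g z)%C = - Re (g z)).
  { intros z. unfold Re. destruct (g z); simpl. ring. }
  rewrite !Ere, !atanh_opp in K2 by auto.
  apply Rabs_le. split; [| exact K1].
  assert (K : - atanh (Re (g l)) - - atanh (Re (g m)) <= atanh (mobius_dist l m)).
  { apply K2; [| exact Hl | exact Hm]. intros z Hz. destruct (Hg z Hz) as [B [d Hd]]. split.
    - rewrite Cmod_mult, Cmod_R, Rabs_left by lra. lra.
    - eexists. apply is_cderive_scal, Hd. }
  lra.
Qed.

(** An automorphism of the target followed by a rotation moves [g m] to 0 and [g l] to a nonnegative
    real, so that passing to real parts loses nothing. *)
Lemma schwarz_pick (g : C -> C) (l m : C) :
  (forall z : C, Cmod z < 1 -> Cmod (g z) < 1 /\ exists d, is_cderive g z d) ->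
  Cmod l < 1 -> Cmod m < 1 ->
  atanh (mobius_dist (g l) (g m)) <= atanh (mobius_dist l m).
Proof.
  intros Hg Hl Hm. assert (Hgl := proj1 (Hg l Hl)). assert (Hgm := proj1 (Hg m Hm)).
  destruct (unimodular_phase (blaschke (g m) (g l))) as [c [Hc E]].
  change (Cmod (blaschke (g m) (g l))) with (mobius_dist (g l) (g m)) in E.
  assert (Hcc : (Cconj c * c)%C = 1).
  { rewrite Cmult_comm, <- Cmod2_conj, Hc. f_equal. ring. }
  assert (K := atanh_re_le (fun z => Cconj c * blaschke (g m) (g z))%C l m).
  cbv beta in K. rewrite E in K.
  replace (Cconj c * (c * mobius_dist (g l) (g m)))%C with (RtoC (mobius_dist (g l) (g m))) in K
    by (rewrite Cmult_assoc, Hcc; ring).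
  replace (Cconj c * blaschke (g m) (g m))%C with (RtoC 0) in K
    by (unfold blaschke, Cdiv; ring).
  simpl Re in K. rewrite atanh_0, Rminus_0_r in K. apply K; [| exact Hl | exact Hm].
  intros z Hz. destruct (Hg z Hz) as [B [d Hd]]. split.
  - rewrite Cmod_mult, Cmod_conj, Hc, Rmult_1_l. apply blaschke_disc; assumption.
  - eexists. apply is_cderive_scal.
    apply (is_cderive_comp (blaschke (g m)) g); [apply is_cderive_blaschke; assumption | exact Hd].
Qed.

(** * Differentiability on C^3 *)

Notation CA := (AbsRing_NormedModule C_AbsRing).

(** The two module structures on [C] have the same operations and norm, and only these enter a
    differential on the codomain side. *)
Lemma filterdiff_C_codomain (U : NormedModule C_AbsRing) (f : U -> C) (F : (U -> Prop) -> Prop) (l : U -> C) :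
  @filterdiff C_AbsRing U C_NormedModule f F l <-> @filterdiff C_AbsRing U CA f F l.
Proof.
  split; intros [[H1 H2 H3] H]; (split; [constructor; assumption | exact H]).
Qed.

Lemma is_cderive_comp_analytic (f : C3 -> C_NormedModule) (phi : C_AbsRing -> C3) (l : C) :
  ex_filterdiff f (locally (phi l)) -> ex_derive phi l ->
  exists d, is_cderive (fun z => f (phi z)) l d.
Proof.
  intros [lf Hf] [dphi Hphi].
  assert (H := filterdiff_comp' phi f l _ _ Hphi Hf).
  exists (lf dphi). apply filterdiff_C_codomain.
  apply (filterdiff_ext_lin _ _ _ H).
  intros y. apply (linear_scal lf). apply Hf.
Qed.

Lemma ex_derive_triple (f1 f2 f3 : C -> C) (l d1 d2 d3 : C) :
  is_cderive f1 l d1 -> is_cderive f2 l d2 -> is_cderive f3 l d3 ->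
  @ex_derive C_AbsRing C3 (fun z => (f1 z, f2 z, f3 z)) l.
Proof.
  intros H1 H2 H3. apply filterdiff_C_codomain in H1. apply filterdiff_C_codomain in H2.
  apply filterdiff_C_codomain in H3.
  exists (d1, d2, d3).
  (* This expanded identity is the uncurried pairing, in the form in which [filterdiff_comp'_2] asks
     for its differential. *)
  assert (L : forall V W : NormedModule C_AbsRing, is_linear (fun t : prod_NormedModule C_AbsRing V W => (fst t, snd t) : prod_NormedModule C_AbsRing V W)).
  { intros V W. apply is_linear_prod; [apply is_linear_fst | apply is_linear_snd]. }
  pose (CC := prod_NormedModule C_AbsRing C_NormedModule C_NormedModule).
  assert (H12 := @filterdiff_comp'_2 C_AbsRing CA C_NormedModule C_NormedModule CC
    f1 f2 (fun u v => (u, v)) l _ _ (fun u v => (u, v)) H1 H2 (filterdiff_linear _ (L _ _))).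
  exact (@filterdiff_comp'_2 C_AbsRing CA CC C_NormedModule C3
    _ f3 (fun u v => (u, v)) l _ _ (fun u v => (u, v)) H12 H3 (filterdiff_linear _ (L _ _))).
Qed.

Lemma filterdiff_quotient (U : NormedModule C_AbsRing) (num den ln ld : U -> C) (x : U) :
  @filterdiff C_AbsRing U CA num (locally x) ln -> @filterdiff C_AbsRing U CA den (locally x) ld ->
  den x <> RtoC 0 -> @ex_filterdiff C_AbsRing U C_NormedModule (fun t => num t / den t)%C (locally x).
Proof.
  intros Hn Hd H0.
  assert (K := @filterdiff_comp' C_AbsRing U CA CA den Cinv x _ _ Hd (is_cderive_Cinv (den x) H0)).
  assert (M := @filterdiff_mult_fct C_AbsRing U num (fun t => / den t)%C x _ _ Cmult_comm Hn K).
  eexists. apply filterdiff_C_codomain. exact M.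
Qed.

Lemma filterdiff_coordinates (x : C3) :
  @filterdiff C_AbsRing C3 CA (fun y => fst (fst y)) (locally x) (fun y => fst (fst y)) /\
  @filterdiff C_AbsRing C3 CA (fun y => snd (fst y)) (locally x) (fun y => snd (fst y)) /\
  @filterdiff C_AbsRing C3 CA (fun y => snd y) (locally x) (fun y => snd y).
Proof.
  pose (CC := prod_NormedModule C_AbsRing C_NormedModule C_NormedModule).
  split; [| split]; apply filterdiff_C_codomain, filterdiff_linear.
  - apply (@is_linear_comp C_AbsRing C3 CC C_NormedModule fst fst); apply is_linear_fst.
  - apply (@is_linear_comp C_AbsRing C3 CC C_NormedModule fst snd); [apply is_linear_fst | apply is_linear_snd].
  - apply is_linear_snd.
Qed.

Lemma ex_filterdiff_linear_fractional (c w : C) (x : C3) :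
  (1 - w * snd (fst x))%C <> 0 ->
  @ex_filterdiff C_AbsRing C3 C_NormedModule
    (fun y => c * (fst (fst y) - w * snd y) / (1 - w * snd (fst y)))%C (locally x).
Proof.
  intros H0. destruct (filterdiff_coordinates x) as (H1 & H2 & H3).
  assert (H3w := @filterdiff_scal_r_fct C_AbsRing C3 CA _ _ w _ _ Cmult_comm H3).
  assert (H2w := @filterdiff_scal_r_fct C_AbsRing C3 CA _ _ w _ _ Cmult_comm H2).
  assert (Hn := @filterdiff_scal_r_fct C_AbsRing C3 CA _ _ c _ _ Cmult_comm
    (@filterdiff_minus_fct C_AbsRing C3 CA _ _ _ _ _ _ H1 H3w)).
  assert (Hd := @filterdiff_minus_fct C_AbsRing C3 CA _ _ _ _ _ _
    (@filterdiff_const C_AbsRing C3 CA (locally x) _ (RtoC 1)) H2w).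
  exact (filterdiff_quotient C3 _ _ _ _ x Hn Hd H0).
Qed.

(** * Geometry of the tetrablock *)

Lemma Cconj_unimodular (c : C) : Cmod c = 1 -> Cconj c = (/ c)%C.
Proof.
  intros Hc. assert (H0 : c <> 0) by (apply Cmod_gt_0; lra).
  assert (E : (c * Cconj c)%C = 1) by (rewrite <- Cmod2_conj, Hc; f_equal; ring).
  replace (Cconj c) with (/ c * (c * Cconj c))%C by (field; exact H0). rewrite E. ring.
Qed.

(** Otherwise [z = (1 - w x2) / (x1 - w x3)] lies in the closed disc and is a zero of the defining
    polynomial; if [x1 - w x3 = 0], then [1 - w x2 = 0] as well and [z = 0] is a zero. *)
Lemma tetrablock_fiber (x1 x2 x3 w : C) :
  tetrablock (x1, x2, x3) -> Cmod w <= 1 -> Cmod (x1 - w * x3)%C < Cmod (1 - w * x2)%C.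
Proof.
  intros H Hw. apply Rnot_le_lt. intros Hle.
  destruct (Req_dec (Cmod (x1 - w * x3)%C) 0) as [E | E].
  - apply (H 0 w); [rewrite Cmod_0; lra | exact Hw |].
    replace (1 - x1 * 0 - x2 * w + x3 * 0 * w)%C with (1 - w * x2)%C by ring.
    apply Cmod_eq_0. assert (G := Cmod_ge_0 (1 - w * x2)%C). lra.
  - assert (G := Cmod_ge_0 (x1 - w * x3)%C).
    assert (H0 : (x1 - w * x3)%C <> 0) by (apply Cmod_gt_0; lra).
    apply (H ((1 - w * x2) / (x1 - w * x3))%C w); [| exact Hw | field; exact H0].
    rewrite Cmod_div by exact H0. apply Rle_div_l; lra.
Qed.

Lemma tetrablock_swap (a b p : C) : tetrablock (a, b, p) -> tetrablock (b, a, p).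
Proof.
  intros H z w Hz Hw E. apply (H w z Hw Hz). rewrite <- E. ring.
Qed.

Lemma tetrablock_snd_lt_1 (a b p : C) : tetrablock (a, b, p) -> Cmod b < 1.
Proof.
  intros H. apply Rnot_le_lt. intros Hle.
  assert (H0 : b <> 0) by (apply Cmod_gt_0; lra).
  apply (H 0 (/ b)%C); [rewrite Cmod_0; lra | | field; exact H0].
  rewrite Cmod_inv by exact H0. rewrite <- Rinv_1. apply Rinv_le_contravar; lra.
Qed.

(** For [|b| < 1], the largest modulus of [(a - p w) / (1 - b w)] over [|w| = 1]: the image of the
    unit disc is the disc with centre [(a - Cconj b p) / (1 - |b|^2)] and radius
    [|a b - p| / (1 - |b|^2)]. *)
Definition gauge (a b p : C) : R :=
  (Cmod (a - Cconj b * p)%C + Cmod (a * b - p)%C) / (1 - Cmod b ^ 2).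

Lemma one_minus_sq_pos (b : C) : Cmod b < 1 -> 0 < 1 - Cmod b ^ 2.
Proof. intros H. assert (G := Cmod_ge_0 b). nra. Qed.

Lemma gauge_ge_0 (a b p : C) : Cmod b < 1 -> 0 <= gauge a b p.
Proof.
  intros Hb. apply one_minus_sq_pos in Hb. unfold gauge.
  apply Rdiv_le_0_compat; [apply Rplus_le_le_0_compat; apply Cmod_ge_0 | exact Hb].
Qed.

(** Subtracting the two equations gives [a - p w = om r (1 - b w)] with [r] the gauge, so [w] is
    extremal; the point of the normal form is that the remaining parameter [K] is real and
    nonnegative. The final inequality is [T <= A + T] in these terms, where [A = |a - Cconj b p|]
    and [T = |a b - p|]. *)
Lemma normal_form (a b p : C) : Cmod b < 1 ->
  exists (om w : C) (K : R), Cmod om = 1 /\ Cmod w = 1 /\ 0 <= K /\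
    a = (om * (gauge a b p - K * (1 - b * w)))%C /\
    (p * w = om * (gauge a b p * (b * w) - K * (1 - b * w)))%C /\
    K * Cmod (1 - b * w)%C ^ 2 <= gauge a b p * (1 - Cmod b ^ 2).
Proof.
  intros Hb. assert (HD := one_minus_sq_pos b Hb).
  destruct (unimodular_phase (a - Cconj b * p)%C) as [om [Hom E1]].
  destruct (unimodular_phase (p - a * b)%C) as [sg [Hsg E2]].
  assert (ET : Cmod (p - a * b)%C = Cmod (a * b - p)%C).
  { rewrite <- (Cmod_opp (a * b - p)%C). f_equal. ring. }
  rewrite ET in E2. unfold gauge.
  assert (HA := Cmod_ge_0 (a - Cconj b * p)%C). assert (HT := Cmod_ge_0 (a * b - p)%C).
  set (A := Cmod (a - Cconj b * p)%C) in *. set (T := Cmod (a * b - p)%C) in *.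
  set (D := 1 - Cmod b ^ 2) in *.
  assert (ED : RtoC D = (1 - b * Cconj b)%C) by (unfold D; rewrite RtoC_minus, Cmod2_conj; reflexivity).
  assert (Hom0 : om <> 0) by (apply Cmod_gt_0; lra).
  assert (Hsg0 : sg <> 0) by (apply Cmod_gt_0; lra).
  assert (Com := Cconj_unimodular om Hom). assert (Csg := Cconj_unimodular sg Hsg).
  (* For [w = (u + Cconj b) / (1 + b u)] the quotient [(a - p w) / (1 - b w)] equals
     [(om A - u sg T) / D]; this [u] gives both terms the phase [om]. *)
  set (u := (- (om / sg))%C). set (e := (1 + b * u)%C).
  assert (Hu : Cmod u = 1) by (unfold u; rewrite Cmod_opp, Cmod_div by exact Hsg0; rewrite Hom, Hsg; field).
  assert (Cu : Cconj u = (- (sg / om))%C).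
  { unfold u. rewrite Copp_conj, Cdiv_conj, Com, Csg by exact Hsg0. field. auto. }
  assert (He : e <> 0).
  { unfold e. replace (1 + b * u)%C with (1 - (- b * u))%C by ring. apply one_minus_neq_0.
    rewrite Cmod_mult, Cmod_opp, Hu. lra. }
  assert (Ce : Cconj e = (1 - Cconj b * (sg / om))%C).
  { unfold e. rewrite Cplus_conj, Cmult_conj, Cu.
    replace (Cconj 1) with (RtoC 1) by (unfold Cconj; simpl; unfold RtoC; f_equal; ring). ring. }
  assert (HDC : RtoC D <> 0) by (intros H; apply RtoC_inj in H; lra).
  assert (Ew : (1 - b * ((u + Cconj b) / e))%C = (D / e)%C).
  { rewrite ED. unfold e. field. exact He. }
  assert (Hem : 0 < Cmod e) by (apply Cmod_gt_0, He).
  (* [w] is the point of the circle where [z |-> (a - p z) / (1 - b z)] is largest. *)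
  exists om, ((u + Cconj b) / e)%C, (T * Cmod e ^ 2 / (D * D)).
  split; [exact Hom |]. split; [| split; [| split; [| split]]].
  - (* For unimodular [u], [u + b' = u (1 + b u)'] with ['] the conjugation. *)
    rewrite Cmod_div by exact He.
    replace (u + Cconj b)%C with (u * Cconj e)%C.
    + rewrite Cmod_mult, Cmod_conj, Hu. field. lra.
    + rewrite Ce. unfold u. field. auto.
  - apply Rdiv_le_0_compat; [| nra]. apply Rmult_le_pos; [exact HT | nra].
  - rewrite Ew. rewrite !RtoC_div, !RtoC_mult, RtoC_plus, Cmod2_conj by nra.
    assert (Ea : (a * D = om * A + Cconj b * sg * T)%C).
    { rewrite ED, <- E1. replace (Cconj b * sg * T)%C with (Cconj b * (sg * T))%C by ring.
      rewrite <- E2. ring. }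
    replace a with (a * D / D)%C by (field; exact HDC). rewrite Ea, Ce. field. auto.
  - rewrite Ew. rewrite !RtoC_div, !RtoC_mult, RtoC_plus, Cmod2_conj by nra.
    assert (Ep : (p * D = b * om * A + sg * T)%C).
    { rewrite ED, <- E2. replace (b * om * A)%C with (b * (om * A))%C by ring.
      rewrite <- E1. ring. }
    replace p with (p * D / D)%C by (field; exact HDC). rewrite Ep, Ce.
    unfold e in *. unfold u in *. field. repeat split; auto.
    intros H. apply He. replace (1 + b * - (om / sg))%C with ((sg + b * - om) / sg)%C by (field; exact Hsg0).
    rewrite H. field. exact Hsg0.
  - rewrite Ew, Cmod_div, Cmod_R, Rabs_pos_eq by (auto; lra).
    replace (T * Cmod e ^ 2 / (D * D) * (D / Cmod e) ^ 2) with T by (field; lra).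
    replace ((A + T) / D * D) with (A + T) by (field; lra). lra.
Qed.

(** At the extremal [w], [|a - w p| = r |1 - w b|], which [tetrablock_fiber] places below
    [|1 - w b|]. *)
Lemma gauge_lt_1 (a b p : C) : tetrablock (a, b, p) -> 0 <= gauge a b p < 1.
Proof.
  intros Hx. assert (Hb := tetrablock_snd_lt_1 a b p Hx).
  assert (Hr := gauge_ge_0 a b p Hb). split; [exact Hr |].
  destruct (normal_form a b p Hb) as (om & w & K & Hom & Hw & HK & Ea & Ep & _).
  assert (F := tetrablock_fiber a b p w Hx ltac:(lra)).
  set (r := gauge a b p) in *.
  replace (a - w * p)%C with (om * r * (1 - w * b))%C in F.
  - rewrite !Cmod_mult, Hom, Cmod_R, Rabs_pos_eq in F by exact Hr.
    assert (G := Cmod_ge_0 (1 - w * b)%C). nra.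
  - replace (w * p)%C with (p * w)%C by ring. rewrite Ep. rewrite Ea at 1. ring.
Qed.

(** The bound by 1 is [tetrablock_fiber] at the extremal [w]; dividing by [om] makes the value at
    the point real and nonnegative. *)
Lemma carath_function (a b p : C) : tetrablock (a, b, p) -> exists f : C3 -> C_NormedModule,
  analytic_to_disc tetrablock f /\ f origin = RtoC 0 :> C /\ f (a, b, p) = RtoC (gauge a b p) :> C.
Proof.
  intros Hx. assert (Hb := tetrablock_snd_lt_1 a b p Hx).
  destruct (normal_form a b p Hb) as (om & w & K & Hom & Hw & HK & Ea & Ep & _).
  assert (Hom0 : om <> 0) by (apply Cmod_gt_0; lra).
  assert (Hden : forall x1 x2 x3, tetrablock (x1, x2, x3) -> (1 - w * x2)%C <> 0).
  { intros x1 x2 x3 H. apply one_minus_neq_0. rewrite Cmod_mult, Hw.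
    assert (G := tetrablock_snd_lt_1 _ _ _ H). lra. }
  exists (fun y => / om * (fst (fst y) - w * snd y) / (1 - w * snd (fst y)))%C.
  split; [| split].
  - intros [[x1 x2] x3] H. split.
    + unfold Defs.disc. simpl fst; simpl snd.
      rewrite Cmod_div, Cmod_mult, Cmod_inv, Hom by (auto; apply (Hden _ _ _ H)).
      assert (F := tetrablock_fiber x1 x2 x3 w H ltac:(lra)).
      apply Rlt_div_l; [apply Cmod_gt_0, (Hden _ _ _ H) |]. lra.
    + apply ex_filterdiff_linear_fractional. exact (Hden _ _ _ H).
  - simpl. field. exact Hom0.
  - simpl fst; simpl snd. assert (H0 := Hden _ _ _ Hx).
    set (r := gauge a b p) in *.
    replace (a - w * p)%C with (a - p * w)%C by ring. rewrite Ep. rewrite Ea at 1.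
    field. auto.
Qed.

(** The expression is [A - zeta B]. Here [Re A > 0], so [A] is nonzero, and [|B| <= |A|] because the
    difference of squares is a sum of nonnegative terms; hence [A = zeta B] is impossible for
    [|zeta| < 1]. *)
Lemma tetra_core (k : R) (zeta mu w : C) :
  0 <= k < 1 -> Cmod zeta < 1 -> Cmod mu < 1 -> Cmod w <= 1 ->
  (1 - k * mu - (1 - k) * zeta - (1 - k) * mu * w + (mu - k) * zeta * w)%C <> 0.
Proof.
  intros Hk Hz Hmu Hw HN.
  set (A := ((1 - k) * (1 - mu * w) + k * (1 - mu))%C).
  set (B := ((1 - k) * (1 - mu * w) + k * (1 - mu) * w)%C).
  assert (EA : A = (zeta * B)%C).
  { replace A with (A - zeta * B - (1 - k * mu - (1 - k) * zeta - (1 - k) * mu * w + (mu - k) * zeta * w)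
      + zeta * B)%C by (rewrite HN; ring).
    unfold A, B. ring. }
  assert (HA : 0 < Cmod A).
  { apply Cmod_gt_0. intros E. assert (R0 : Re A = 0) by (rewrite E; reflexivity).
    assert (R1 : Re A = (1 - k) * (1 - Re (mu * w)%C) + k * (1 - Re mu)).
    { unfold A, Re, Im. destruct mu, w; simpl. ring. }
    assert (M1 := re_le_Cmod (mu * w)%C). assert (M2 := re_le_Cmod mu).
    rewrite Cmod_mult in M1. assert (G1 := Cmod_ge_0 mu). assert (G2 := Cmod_ge_0 w).
    assert (Cmod mu * Cmod w < 1) by nra.
    apply Rabs_le_between in M1. apply Rabs_le_between in M2. nra. }
  assert (HBA : Cmod B ^ 2 <= Cmod A ^ 2).
  { assert (E : Cmod A ^ 2 - Cmod B ^ 2 = k ^ 2 * Cmod (1 - mu)%C ^ 2 * (1 - Cmod w ^ 2)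
      + k * (1 - k) * ((1 - Cmod mu ^ 2) * Cmod (1 - w)%C ^ 2 + (1 - Cmod w ^ 2) * Cmod (1 - mu)%C ^ 2)).
    { rewrite !Cmod2_alt. unfold A, B, Re, Im. destruct mu, w; simpl. ring. }
    assert (G1 := Cmod_ge_0 mu). assert (G2 := Cmod_ge_0 w).
    assert (0 <= 1 - Cmod w ^ 2) by nra. assert (0 <= 1 - Cmod mu ^ 2) by nra.
    assert (S1 := pow2_ge_0 (Cmod (1 - mu)%C)). assert (S2 := pow2_ge_0 (Cmod (1 - w)%C)).
    assert (0 <= k ^ 2 * Cmod (1 - mu)%C ^ 2 * (1 - Cmod w ^ 2)).
    { apply Rmult_le_pos; [apply Rmult_le_pos |]; nra. }
    assert (0 <= k * (1 - k) * ((1 - Cmod mu ^ 2) * Cmod (1 - w)%C ^ 2 + (1 - Cmod w ^ 2) * Cmod (1 - mu)%C ^ 2)).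
    { apply Rmult_le_pos; [nra |]. apply Rplus_le_le_0_compat; apply Rmult_le_pos; assumption. }
    lra. }
  assert (GB := Cmod_ge_0 B). assert (GZ := Cmod_ge_0 zeta).
  assert (EM : Cmod A = Cmod zeta * Cmod B) by (rewrite EA at 1; apply Cmod_mult).
  assert (HBA' : Cmod B <= Cmod A) by (apply Rnot_lt_le; intros H; nra).
  nra.
Qed.

(** The condition [|b| <= |a|] gives [b = 0] when [a = 0]; otherwise it gives [K < r], hence
    [k < 1], and [|q| = |b| / |a| <= 1]. *)
Lemma extremal_disc (a b p : C) : tetrablock (a, b, p) -> Cmod b <= Cmod a ->
  exists f1 f2 f3 : C -> C,
    (forall l : C, Cmod l < 1 -> tetrablock (f1 l, f2 l, f3 l) /\
      (exists d, is_cderive f1 l d) /\ (exists d, is_cderive f2 l d) /\ (exists d, is_cderive f3 l d)) /\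
    f1 0 = RtoC 0 /\ f2 0 = RtoC 0 /\ f3 0 = RtoC 0 /\
    f1 (gauge a b p) = a /\ f2 (gauge a b p) = b /\ f3 (gauge a b p) = p.
Proof.
  intros Hx Hba. assert (Hb := tetrablock_snd_lt_1 a b p Hx).
  (* Up to a phase, [q] below is a quotient by [a]; for [a = 0] the point is [(0, 0, p)] and a
     linear disc reaches it. *)
  destruct (Req_dec (Cmod a) 0) as [Ha | Ha].
  - assert (Hb0 : Cmod b = 0) by (assert (G := Cmod_ge_0 b); lra).
    apply Cmod_eq_0 in Ha. apply Cmod_eq_0 in Hb0. subst a b.
    destruct (unimodular_phase p) as [c [Hc E]].
    exists (fun _ => 0), (fun _ => 0), (fun l => c * l)%C.
    assert (Er : gauge 0 0 p = Cmod p).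
    { unfold gauge. rewrite Cmod_0. replace (0 - Cconj 0 * p)%C with (RtoC 0).
      - replace (0 * 0 - p)%C with (- p)%C by ring. rewrite Cmod_0, Cmod_opp. field.
      - replace (Cconj 0) with (RtoC 0); [ring |]. unfold Cconj, RtoC; simpl. f_equal. ring. }
    rewrite Er. repeat split; try ring; try (symmetry; exact E).
    + intros z w Hz Hw. replace (1 - 0 * z - 0 * w + c * l * z * w)%C with (1 - - c * l * z * w)%C by ring.
      apply one_minus_neq_0. rewrite !Cmod_mult, Cmod_opp, Hc, Rmult_1_l.
      assert (G1 := Cmod_ge_0 l). assert (G2 := Cmod_ge_0 z). assert (G3 := Cmod_ge_0 w).
      assert (0 <= Cmod l * Cmod z <= Cmod l) by nra. nra.
    + eexists. apply is_cderive_const.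
    + eexists. apply is_cderive_const.
    + eexists. apply is_cderive_scal, is_cderive_id.
  - destruct (normal_form a b p Hb) as (om & w & K & Hom & Hw & HK & Ea & Ep & HKn).
    assert (Hr0 := gauge_ge_0 a b p Hb). set (r := gauge a b p) in *.
    assert (Hom0 : om <> 0) by (apply Cmod_gt_0; lra).
    assert (Hw0 : w <> 0) by (apply Cmod_gt_0; lra).
    assert (Hapos : 0 < Cmod a) by (assert (G := Cmod_ge_0 a); lra).
    assert (Esq : Cmod a ^ 2 = r ^ 2 - 2 * r * K * (1 - Re (b * w)%C) + K ^ 2 * Cmod (1 - b * w)%C ^ 2).
    { rewrite Ea at 1. rewrite Cmod_mult, Hom, Rmult_1_l, !Cmod2_alt. unfold Re, Im.
      destruct (b * w)%C; simpl. ring. }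
    assert (En : Cmod (1 - b * w)%C ^ 2 = 1 - 2 * Re (b * w)%C + Cmod b ^ 2).
    { replace (Cmod b) with (Cmod (b * w)%C) by (rewrite Cmod_mult, Hw; ring).
      rewrite !Cmod2_alt. unfold Re, Im. destruct (b * w)%C; simpl. ring. }
    set (n := Cmod (1 - b * w)%C ^ 2) in *. set (beta := Cmod b ^ 2) in *.
    assert (Hn : 0 <= n) by apply pow2_ge_0.
    assert (Hbeta : 0 <= beta < 1).
    { unfold beta. split; [apply pow2_ge_0 |]. assert (G := Cmod_ge_0 b). nra. }
    assert (Hab2 : beta <= Cmod a ^ 2) by (unfold beta; assert (G := Cmod_ge_0 b); nra).
    (* By [En], [2 (1 - Re (b w)) = n + 1 - beta]; in this form the bound [HKn] on [K n] can be
       used. *)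
    assert (Esq' : Cmod a ^ 2 = r ^ 2 - r * K * (n + 1 - beta) + K ^ 2 * n) by (rewrite Esq; nra).
    assert (Ha2 : 0 < Cmod a ^ 2) by nra.
    assert (Hr1 : r < 1) by apply (gauge_lt_1 a b p Hx).
    assert (Hrpos : 0 < r).
    { destruct Hr0 as [H | H]; [exact H | exfalso]. rewrite <- H in Esq', HKn.
      assert (K * n = 0) by nra. nra. }
    (* Were [K >= r], the bound on [K n] would give [|a|^2 <= r^2 |b|^2 <= r^2 |a|^2], against
       [r < 1] and [a <> 0]. *)
    assert (HKr : K < r).
    { apply Rnot_le_lt. intros HrK.
      assert (Q : Cmod a ^ 2 <= r ^ 2 * beta).
      { rewrite Esq'. assert ((K - r) * (K * n) <= (K - r) * (r * (1 - beta))) by (apply Rmult_le_compat_l; lra). nra. }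
      assert (R2 : r ^ 2 < 1) by nra.
      assert (r ^ 2 * beta <= r ^ 2 * Cmod a ^ 2) by (apply Rmult_le_compat_l; nra).
      assert (0 < (1 - r ^ 2) * Cmod a ^ 2) by (apply Rmult_lt_0_compat; lra). lra. }
    set (k := K / r).
    assert (Hk : 0 <= k < 1).
    { unfold k. split; [apply Rdiv_le_0_compat; lra | apply Rlt_div_l; lra]. }
    assert (EK : RtoC K = (k * r)%C) by (rewrite <- RtoC_mult; unfold k; f_equal; field; lra).
    set (s := (b * w)%C) in *. set (t := (1 - k + k * s)%C).
    assert (Ea' : a = (om * r * t)%C) by (rewrite Ea, EK; unfold t; ring).
    assert (Ep' : p = (om * r * (s - k + k * s) / w)%C).
    { replace p with (p * w / w)%C by (field; exact Hw0). rewrite Ep, EK. field. exact Hw0. }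
    assert (Eb : b = (s / w)%C) by (unfold s; field; exact Hw0).
    assert (Hr0C : RtoC r <> 0) by (intros H; apply RtoC_inj in H; lra).
    assert (H1k : (1 - k)%C <> 0).
    { rewrite <- RtoC_minus. intros H. apply RtoC_inj in H. lra. }
    assert (Ha0 : a <> 0) by (apply Cmod_gt_0; lra).
    assert (Ht0 : t <> 0).
    { intros H. apply Ha0. rewrite Ea', H. ring. }
    (* With this [q] the second coordinate of the disc at [l = r] is [q r t / w = s / w = b]. *)
    set (q := (s / (r * t))%C).
    assert (Hq : Cmod q <= 1).
    { unfold q. replace (s / (r * t))%C with (s * om / a)%C.
      - rewrite Cmod_div by exact Ha0. unfold s. rewrite !Cmod_mult, Hw, Hom.
        apply Rle_div_l; lra.
      - rewrite Ea'. field. auto. }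
    assert (Hql : forall l : C, Cmod l < 1 -> Cmod (q * l)%C < 1).
    { intros l Hl. rewrite Cmod_mult. assert (G := Cmod_ge_0 l). assert (G2 := Cmod_ge_0 q). nra. }
    assert (Hden : forall l : C, Cmod l < 1 -> (1 - k * (q * l))%C <> 0).
    { intros l Hl. apply one_minus_neq_0. rewrite Cmod_mult, Cmod_R, Rabs_pos_eq by lra.
      assert (G := Cmod_ge_0 (q * l)%C). specialize (Hql l Hl). nra. }
    assert (Dden : forall l : C, Cmod l < 1 -> exists d, is_cderive (fun l => / (1 - k * (q * l)))%C l d).
    { intros l Hl. eexists. apply (is_cderive_inv (fun l => 1 - k * (q * l))%C); [| exact (Hden l Hl)].
      apply is_cderive_minus; [apply is_cderive_const |].
      apply is_cderive_scal, is_cderive_scal, is_cderive_id. }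
    assert (Edr : (1 - k * (q * r))%C = ((1 - k) / t)%C).
    { unfold q. replace (1 - k)%C with (t - k * s)%C at 1 by (unfold t; ring). field. auto. }
    exists (fun l => om * (1 - k) * l * / (1 - k * (q * l)))%C,
      (fun l => / w * (1 - k) * q * l * / (1 - k * (q * l)))%C,
      (fun l => om / w * l * (q * l - k) * / (1 - k * (q * l)))%C.
    split; [| repeat split].
    + intros l Hl. destruct (Dden l Hl) as [d Hd]. split; [| repeat split].
      * intros z w' Hz Hw' E.
        (* Multiplied by the denominator [1 - k q l], the defining polynomial at [z] and [w'] is the
           one of [tetra_core] at these arguments. *)
        apply (tetra_core k (om * l * z)%C (q * l)%C (w' / w)%C Hk).
        -- rewrite !Cmod_mult, Hom. assert (G1 := Cmod_ge_0 l). assert (G2 := Cmod_ge_0 z). nra.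
        -- exact (Hql l Hl).
        -- rewrite Cmod_div, Hw by exact Hw0. lra.
        -- apply (f_equal (fun x => x * (1 - k * (q * l)))%C) in E.
           rewrite Cmult_0_l in E. rewrite <- E. field. split; [exact (Hden l Hl) | exact Hw0].
      * eexists. apply is_cderive_mult; [apply is_cderive_scal, is_cderive_id | exact Hd].
      * eexists. apply is_cderive_mult; [apply is_cderive_scal, is_cderive_id | exact Hd].
      * eexists. apply is_cderive_mult; [| exact Hd].
        apply is_cderive_mult; [apply is_cderive_scal, is_cderive_id |].
        apply is_cderive_minus; [apply is_cderive_scal, is_cderive_id | apply is_cderive_const].
    + ring.
    + ring.
    + ring.
    + rewrite Edr, Ea'. field. auto.
    + rewrite Edr, Eb. unfold q. field. auto.
    + rewrite Edr, Ep'. unfold q.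
      replace (s / (r * t) * r - k)%C with ((1 - k) * (s - k + k * s) / t)%C.
      * field. auto.
      * unfold t in *. field. auto.
Qed.

(** * The invariant distances *)

Lemma analytic_comp_disc (U : C3 -> Prop) (f : C3 -> C_NormedModule) (phi : C_AbsRing -> C3) :
  analytic_to_disc U f -> analytic_disc_in U phi ->
  forall z : C, Cmod z < 1 -> Cmod (f (phi z)) < 1 /\ exists d, is_cderive (fun z => f (phi z)) z d.
Proof.
  intros Hf Hphi z Hz. destruct (Hphi z Hz) as [HU Hd]. destruct (Hf _ HU) as [Hdf Df].
  split; [exact Hdf |]. apply is_cderive_comp_analytic; assumption.
Qed.

(* A pseudodistance below the Lempert function for which the triangle inequality
   is immediate, unlike for [atanh (mobius_dist (f x) (f y))]; on pairs with [f x = 0]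
   and [f y] nonnegative real the two agree. *)
Definition re_pseudodistance (f : C3 -> C) (x y : C3) : R :=
  Rabs (atanh (Re (f x)) - atanh (Re (f y))).

Lemma re_pseudodistance_disc (U : C3 -> Prop) (f : C3 -> C_NormedModule) (phi : C_AbsRing -> C3) (l m : C) :
  analytic_to_disc U f -> analytic_disc_in U phi -> Defs.disc l -> Defs.disc m ->
  re_pseudodistance f (phi l) (phi m) <= atanh (mobius_dist l m).
Proof.
  intros Hf Hphi Hl Hm.
  exact (atanh_re_abs_le _ l m (analytic_comp_disc U f phi Hf Hphi) Hl Hm).
Qed.

Lemma re_pseudodistance_spec (U : C3 -> Prop) (f : C3 -> C_NormedModule) :
  analytic_to_disc U f ->
  pseudodistance U (re_pseudodistance f) /\ below_lempert U (re_pseudodistance f).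
Proof.
  intros Hf. split.
  - repeat split; unfold re_pseudodistance; intros.
    + apply Rabs_pos.
    + rewrite Rminus_diag_eq by reflexivity. apply Rabs_R0.
    + apply Rabs_minus_sym.
    + eapply Rle_trans; [| apply Rabs_triang]. apply Req_le. f_equal. ring.
  - intros x y Hx Hy. apply Glb_Rbar_correct.
    intros r (l & m & phi & Hl & Hm & Hphi & <- & <- & ->). simpl.
    apply (re_pseudodistance_disc U); assumption.
Qed.

Lemma atanh_ge_0 (u : R) : 0 <= u < 1 -> 0 <= atanh u.
Proof. intros Hu. rewrite <- atanh_0. apply atanh_le; lra. Qed.

Lemma analytic_disc_to (a b p : C) (f1 f2 f3 : C -> C) (r : R) :
  0 <= r < 1 ->
  (forall l : C, Cmod l < 1 -> tetrablock (f1 l, f2 l, f3 l) /\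
      (exists d, is_cderive f1 l d) /\ (exists d, is_cderive f2 l d) /\ (exists d, is_cderive f3 l d)) ->
  f1 0 = RtoC 0 -> f2 0 = RtoC 0 -> f3 0 = RtoC 0 -> f1 r = a -> f2 r = b -> f3 r = p ->
  exists (l m : C) (phi : C_AbsRing -> C3),
    Defs.disc l /\ Defs.disc m /\ analytic_disc_in tetrablock phi /\
    phi l = origin /\ phi m = (a, b, p) /\ atanh r = atanh (mobius_dist l m).
Proof.
  intros Hr H E1 E2 E3 <- <- <-.
  exists (RtoC 0), (RtoC r), (fun z => (f1 z, f2 z, f3 z)).
  split; [| split; [| split; [| split; [| split]]]].
  - unfold Defs.disc. rewrite Cmod_0. lra.
  - unfold Defs.disc. rewrite Cmod_R, Rabs_pos_eq; lra.
  - intros l Hl. destruct (H l Hl) as (T & [d1 D1] & [d2 D2] & [d3 D3]).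
    split; [exact T |]. exact (ex_derive_triple f1 f2 f3 l d1 d2 d3 D1 D2 D3).
  - rewrite E1, E2, E3. reflexivity.
  - reflexivity.
  - f_equal. unfold mobius_dist. replace ((0 - r) / (1 - Cconj r * 0))%C with (- r)%C by field.
    rewrite Cmod_opp, Cmod_R, Rabs_pos_eq; lra.
Qed.

(** Exchanging the first two coordinates allows [|b| <= |a|]. One gauge suffices: both bound every
    disc from below, so the one that is reached is the larger. *)
Lemma extremal_disc_in (a b p : C) : tetrablock (a, b, p) ->
  exists r, (r = gauge a b p \/ r = gauge b a p) /\
  exists (l m : C) (phi : C_AbsRing -> C3),
    Defs.disc l /\ Defs.disc m /\ analytic_disc_in tetrablock phi /\
    phi l = origin /\ phi m = (a, b, p) /\ atanh r = atanh (mobius_dist l m).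
Proof.
  intros Hx. destruct (Rle_dec (Cmod b) (Cmod a)) as [Hba | Hba].
  - exists (gauge a b p). split; [left; reflexivity |].
    destruct (extremal_disc a b p Hx Hba) as (f1 & f2 & f3 & H & E1 & E2 & E3 & K1 & K2 & K3).
    apply (analytic_disc_to a b p f1 f2 f3); try assumption. apply gauge_lt_1, Hx.
  - exists (gauge b a p). split; [right; reflexivity |].
    assert (Hx' := tetrablock_swap _ _ _ Hx).
    destruct (extremal_disc b a p Hx' ltac:(lra)) as (f1 & f2 & f3 & H & E1 & E2 & E3 & K1 & K2 & K3).
    apply (analytic_disc_to a b p f2 f1 f3); try assumption.
    + apply gauge_lt_1, Hx'.
    + intros l Hl. destruct (H l Hl) as (T & D1 & D2 & D3).
      split; [apply tetrablock_swap, T | auto].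
Qed.

Definition swap (x : C3) : C3 := (snd (fst x), fst (fst x), snd x).

Lemma analytic_to_disc_swap (f : C3 -> C_NormedModule) :
  analytic_to_disc tetrablock f -> analytic_to_disc tetrablock (fun x => f (swap x)).
Proof.
  intros Hf x Hx.
  assert (Hs : tetrablock (swap x)) by (destruct x as [[x1 x2] x3]; apply tetrablock_swap, Hx).
  destruct (Hf _ Hs) as [Hd [lf Df]]. split; [exact Hd |].
  exists (fun y => lf (swap y)).
  apply (@filterdiff_comp' C_AbsRing C3 C3 C_NormedModule swap f); [| exact Df].
  apply filterdiff_linear.
  pose (CC := prod_NormedModule C_AbsRing C_NormedModule C_NormedModule).
  assert (LF : @is_linear C_AbsRing C3 CC fst) by apply is_linear_fst.
  apply (@is_linear_prod C_AbsRing C3 CC C_NormedModule (fun x => (snd (fst x), fst (fst x))) snd);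
    [| apply is_linear_snd].
  apply (@is_linear_prod C_AbsRing C3 C_NormedModule C_NormedModule (fun x => snd (fst x)) (fun x => fst (fst x))).
  - apply (@is_linear_comp C_AbsRing C3 CC C_NormedModule fst snd); [exact LF | apply is_linear_snd].
  - apply (@is_linear_comp C_AbsRing C3 CC C_NormedModule fst fst); [exact LF | apply is_linear_fst].
Qed.

Lemma carath_function_each (a b p : C) (r : R) : tetrablock (a, b, p) ->
  r = gauge a b p \/ r = gauge b a p -> 0 <= r < 1 /\ exists f : C3 -> C_NormedModule,
  analytic_to_disc tetrablock f /\ f origin = RtoC 0 :> C /\ f (a, b, p) = RtoC r :> C.
Proof.
  intros Hx [-> | ->].
  - split; [apply gauge_lt_1, Hx | apply carath_function, Hx].
  - assert (Hx' := tetrablock_swap _ _ _ Hx). split; [apply gauge_lt_1, Hx' |].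
    destruct (carath_function b a p Hx') as (f & Hf & E0 & E1).
    exists (fun x => f (swap x)). split; [apply analytic_to_disc_swap, Hf | split; [exact E0 | exact E1]].
Qed.

(** Each of the two functions into the disc bounds all discs through the two points from below, and
    the extremal disc reaches one of these bounds. *)
Lemma lempert_origin (a b p : C) : tetrablock (a, b, p) ->
  lempert tetrablock origin (a, b, p) = Finite (Rmax (atanh (gauge a b p)) (atanh (gauge b a p))).
Proof.
  intros Hx. apply is_glb_Rbar_unique. split.
  - intros d (l & m & phi & Hl & Hm & Hphi & E0 & E1 & ->). simpl.
    assert (K : forall r, r = gauge a b p \/ r = gauge b a p -> atanh r <= atanh (mobius_dist l m)).
    { intros r Hr. destruct (carath_function_each a b p r Hx Hr) as (Hr1 & f & Hf & F0 & F1).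
      assert (Q := re_pseudodistance_disc tetrablock f phi l m Hf Hphi Hl Hm).
      unfold re_pseudodistance in Q. rewrite E0, E1, F0, F1 in Q. simpl Re in Q.
      rewrite atanh_0, Rabs_minus_sym, Rminus_0_r, Rabs_pos_eq in Q by (apply atanh_ge_0, Hr1).
      exact Q. }
    apply Rmax_lub; apply K; auto.
  - intros d Hd. destruct (extremal_disc_in a b p Hx) as (r & Hr & D).
    apply Rbar_le_trans with (Finite (atanh r)); [apply Hd, D |].
    destruct Hr as [-> | ->]; [apply Rmax_l | apply Rmax_r].
Qed.

(** Composed with the extremal disc, every competing function obeys [schwarz_pick]; the two
    functions of [carath_function_each] give the lower bounds. *)
Lemma caratheodory_origin (a b p : C) : tetrablock (a, b, p) ->
  caratheodory tetrablock origin (a, b, p) = Finite (Rmax (atanh (gauge a b p)) (atanh (gauge b a p))).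
Proof.
  intros Hx. apply is_lub_Rbar_unique. split.
  - intros d (f & Hf & ->). destruct (extremal_disc_in a b p Hx) as (r & Hr & D).
    apply Rbar_le_trans with (Finite (atanh r)).
    + destruct D as (l & m & phi & Hl & Hm & Hphi & <- & <- & ->).
      exact (schwarz_pick _ l m (analytic_comp_disc tetrablock f phi Hf Hphi) Hl Hm).
    + destruct Hr as [-> | ->]; [apply Rmax_l | apply Rmax_r].
  - intros d Hd.
    assert (K : forall r, r = gauge a b p \/ r = gauge b a p -> Rbar_le (atanh r) d).
    { intros r Hr. destruct (carath_function_each a b p r Hx Hr) as (Hr1 & f & Hf & F0 & F1).
      apply Hd. exists f. split; [exact Hf |].
      rewrite F0, F1. f_equal. unfold mobius_dist.
      replace ((0 - r) / (1 - Cconj r * 0))%C with (- r)%C by field.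
      rewrite Cmod_opp, Cmod_R, Rabs_pos_eq; lra. }
    unfold Rmax. destruct Rle_dec; apply K; auto.
Qed.

(** * Existence and value of the Kobayashi distance *)

Lemma origin_in_tetrablock : tetrablock origin.
Proof.
  intros z w _ _ H. replace (1 - 0 * z - 0 * w + 0 * z * w)%C with (RtoC 1) in H by ring.
  apply RtoC_inj in H. lra.
Qed.

Lemma lempert_ge_0 (U : C3 -> Prop) (x y : C3) : Rbar_le 0 (lempert U x y).
Proof.
  apply Glb_Rbar_correct. intros r (l & m & phi & Hl & Hm & _ & _ & _ & ->).
  apply atanh_ge_0, mobius_dist_lt_1; assumption.
Qed.

(** The pointwise supremum of all pseudodistances below the Lempert function works; it is finite
    because the triangle inequality through [x0] bounds each of them at [(x, y)] by [M x + M y]. *)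
Lemma kobayashi_exists (U : C3 -> Prop) (x0 : C3) (M : C3 -> R) :
  U x0 -> (forall x, U x -> Rbar_le (lempert U x0 x) (M x)) -> exists k, is_kobayashi U k.
Proof.
  intros U0 HM.
  set (E := fun x y r => exists rho, pseudodistance U rho /\ below_lempert U rho /\ r = rho x y).
  assert (Hbound : forall x y, U x -> U y -> forall r, E x y r -> r <= M x + M y).
  { intros x y Hx Hy r (rho & (P0 & P1 & P2 & P3) & HB & ->).
    assert (B1 := Rbar_le_trans _ _ _ (HB _ _ U0 Hx) (HM x Hx)).
    assert (B2 := Rbar_le_trans _ _ _ (HB _ _ U0 Hy) (HM y Hy)). simpl in B1, B2.
    assert (T := P3 x x0 y Hx U0 Hy). rewrite (P2 x x0 Hx U0) in T. lra. }
  (* The zero pseudodistance is a competitor, so the supremum is not [m_infty] and is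
     nonnegative. *)
  assert (H0 : forall x y, E x y 0).
  { intros x y. exists (fun _ _ => 0). repeat split; intros; try lra. intros u v _ _. apply lempert_ge_0. }
  set (k := fun x y => real (Lub_Rbar (E x y))).
  assert (Hk : forall x y, U x -> U y -> is_lub_Rbar (E x y) (k x y)).
  { intros x y Hx Hy. unfold k. assert (L := Lub_Rbar_correct (E x y)).
    destruct (Lub_Rbar (E x y)) as [v | |]; simpl.
    - exact L.
    - destruct L as [_ L]. exfalso. apply (L (M x + M y)). intros r Hr. apply (Hbound x y Hx Hy r Hr).
    - destruct L as [L _]. exfalso. apply (L 0), H0. }
  assert (Hup : forall x y r, U x -> U y -> E x y r -> r <= k x y).
  { intros x y r Hx Hy Hr. exact (proj1 (Hk x y Hx Hy) r Hr). }
  assert (Hlub : forall x y (B : R), U x -> U y -> (forall r, E x y r -> r <= B) -> k x y <= B).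
  { intros x y B Hx Hy HB. exact (proj2 (Hk x y Hx Hy) B HB). }
  assert (Hsym : forall x y, U x -> U y -> k x y <= k y x).
  { intros x y Hx Hy. apply Hlub; [exact Hx | exact Hy |]. intros r (rho & HP & HB & ->).
    apply Hup; [exact Hy | exact Hx |]. exists rho. split; [exact HP |]. split; [exact HB |].
    apply HP; assumption. }
  exists k. split; [| split].
  - split; [| split; [| split]].
    + intros x y Hx Hy. apply Hup; auto.
    + intros x Hx. apply Rle_antisym; [| apply Hup; auto].
      apply Hlub; auto. intros r (rho & HP & HB & ->). apply Req_le, HP, Hx.
    + intros x y Hx Hy. apply Rle_antisym; auto.
    + intros x y z Hx Hy Hz. apply Hlub; auto. intros r (rho & HP & HB & ->).
      apply Rle_trans with (rho x y + rho y z); [apply HP; assumption |].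
      apply Rplus_le_compat; apply Hup; auto; exists rho; auto.
  - intros x y Hx Hy. apply (proj2 (Hk x y Hx Hy)). intros r (rho & HP & HB & ->).
    apply HB; assumption.
  - intros rho HP HB x y Hx Hy. apply Hup; auto. exists rho; auto.
Qed.

(** [lempert_origin] makes the Lempert function from the origin finite, hence a bound [M] for
    [kobayashi_exists]; [epsilon] then picks a genuine largest pseudodistance. *)
Lemma is_kobayashi_tetrablock : is_kobayashi tetrablock (kobayashi tetrablock).
Proof.
  apply (epsilon_spec (inhabits (fun _ _ : C3 => 0)) (is_kobayashi tetrablock)).
  apply (kobayashi_exists tetrablock origin
    (fun x => real (lempert tetrablock origin x)) origin_in_tetrablock).
  intros x Hx. assert (E : exists v : R, lempert tetrablock origin x = Finite v).
  { destruct x as [[a b] p]. eexists. exact (lempert_origin a b p Hx). }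
  destruct E as [v E]. rewrite E. apply Rbar_le_refl.
Qed.

(** The upper bound is the Lempert function; for the lower bound, [re_pseudodistance] of each
    function into the disc competes in the maximum. *)
Lemma kobayashi_origin (a b p : C) : tetrablock (a, b, p) ->
  kobayashi tetrablock origin (a, b, p) = Rmax (atanh (gauge a b p)) (atanh (gauge b a p)).
Proof.
  intros Hx. destruct is_kobayashi_tetrablock as (_ & HB & Hmax). apply Rle_antisym.
  - assert (K := HB _ _ origin_in_tetrablock Hx). rewrite (lempert_origin a b p Hx) in K. exact K.
  - assert (K : forall r, r = gauge a b p \/ r = gauge b a p ->
      atanh r <= kobayashi tetrablock origin (a, b, p)).
    { intros r Hr. destruct (carath_function_each a b p r Hx Hr) as (Hr1 & f & Hf & F0 & F1).
      destruct (re_pseudodistance_spec tetrablock f Hf) as [HP HL].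
      assert (Q := Hmax _ HP HL _ _ origin_in_tetrablock Hx).
      unfold re_pseudodistance in Q. rewrite F0, F1 in Q. simpl Re in Q.
      rewrite atanh_0, Rabs_minus_sym, Rminus_0_r, Rabs_pos_eq in Q by (apply atanh_ge_0, Hr1).
      exact Q. }
    apply Rmax_lub; apply K; auto.
Qed.

Theorem corollary3p7 (a b p : C) (hx : tetrablock (a, b, p)) :
  caratheodory tetrablock origin (a, b, p) =
    Finite (kobayashi tetrablock origin (a, b, p)) /\
  Finite (kobayashi tetrablock origin (a, b, p)) =
    lempert tetrablock origin (a, b, p) /\
  lempert tetrablock origin (a, b, p) =
    Finite (Rmax
      (atanh ((Cmod (a - Cconj b * p)%C + Cmod (a * b - p)%C) / (1 - Cmod b ^ 2)))
      (atanh ((Cmod (b - Cconj a * p)%C + Cmod (a * b - p)%C) / (1 - Cmod a ^ 2)))).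
Proof.
  rewrite (caratheodory_origin a b p hx), (kobayashi_origin a b p hx), (lempert_origin a b p hx).
  unfold gauge. rewrite (Cmult_comm b a). repeat split; reflexivity.
Qed.
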